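(* Consider the model of the context, and let $A1$, $A1'$, $A2(a)$, $A2(b)$ denote the assumptions spelled out there, with $a\in\mathbb{R}$, $b\in(0,1]$, $g:\Theta\to\mathbb{R}^d$ as in $A1$. 1. Under $A1$ and $A2(a)$, as $n\to\infty$, $$\mathrm{KS}\Big(p\big(n^b(n^{-a}s-g(\theta))\,\big|\,\theta,n\big),\;p\big(n_{\mathrm{dp}}^b(n_{\mathrm{dp}}^{-a}s-g(\theta))\,\big|\,\theta,n\big)\Big)\to 0 .$$ If $p(\theta)$ is a proper prior, then also $$\mathrm{KS}\Big(p\big(\theta,\,n^b(n^{-a}s-g(\theta))\,\big|\,n\big),\;p\big(\theta,\,n_{\mathrm{dp}}^b(n_{\mathrm{dp}}^{-a}s-g(\theta))\,\big|\,n\big)\Big)\to 0 .$$ 2. Under $A1$ and $A2(b)$, as $n_0\to\infty$, $$\mathrm{KS}\big(p(s\mid\theta,n=n_0),\,p(s\mid\theta,n_{\mathrm{dp}}=n_0)\big)\to0 .$$ If $p(\theta)$ is a proper prior, then $\mathrm{KS}\big(p(\theta,s\mid n=n_0),\,p(\theta,s\mid n_{\mathrm{dp}}=n_0)\big)\to0$ as well. Replacing $A1$ with $A1'$, all of these convergence results hold in total variation distance, i.e., with $\mathrm{KS}$ replaced by $\mathrm{TV}$.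
   Context: Distances: for probability measures $P,Q$ on a Euclidean space, $\mathrm{TV}(P,Q)=\sup_S|P(S)-Q(S)|$ over measurable sets $S$, and $\mathrm{KS}(P,Q)=\sup_R|P(R)-Q(R)|$ over axis-aligned rectangles $R$. We write $p(\cdot\mid\cdot)$ both for a (conditional) density/pmf and for the corresponding distribution. Model: $\theta\in\Theta\subseteq\mathbb{R}^p$ is a parameter with prior $p(\theta)$; $n\in\{1,2,\dots\}$ is the unobserved sample size with prior $p(n)$; given $(\theta,n)$ the sensitive dataset $x$ of size $n$ has distribution $p(x\mid\theta,n)$; the privatized summary $s\in\mathbb{R}^d$ is drawn from $p(s\mid x)$, and the privatized sample size $n_{\mathrm{dp}}\in\mathbb{R}$ is drawn from $p(n_{\mathrm{dp}}\mid n)$. The joint model is $p(\theta,s,n,n_{\mathrm{dp}})=\int p(s\mid x)p(x\mid\theta,n)p(\theta)p(n_{\mathrm{dp}}\mid n)p(n)\,dx$; in particular, $s$ and $n_{\mathrm{dp}}$ are conditionally independent given $(x,n)$; given $n$, $n_{\mathrm{dp}}$ is independent of $(x,\theta)$; given $x$, $s$ is independent of $\theta$. Thus $p(s\mid\theta,n)=\int p(s\mid x)p(x\mid\theta,n)\,dx$, $p(s\mid\theta,n_{\mathrm{dp}})=\sum_{k\ge1}p(s\mid\theta,n=k)\,p(n=k\mid n_{\mathrm{dp}})$, $p(\theta,s\mid n)=p(\theta)p(s\mid\theta,n)$ and $p(\theta,s\mid n_{\mathrm{dp}})=\sum_{k\ge1}p(\theta,s\mid n=k)\,p(n=k\mid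 n_{\mathrm{dp}})$. Assumptions: - $A1$: the sequence of random variables $(s\mid\theta,n=n_0)$, indexed by $n_0$, has an asymptotic distribution: there exist $b\in(0,1]$, $a\in\mathbb{R}$ and a function $g:\Theta\to\mathbb{R}^d$ such that $n_0^b(n_0^{-a}s-g(\theta))$ converges in distribution to $X$ as $n_0\to\infty$, where $X$ is a mean-zero continuous random variable. - $A1'$: $A1$ holds, but where convergence is in total variation. - $A2$: assuming $A1$ holds, let $a_{n_0}$ be a sequence such that $a_{n_0}=o(n_0)$ if $a=0$ in $A1$, and $a_{n_0}=o(n_0^{1-b})$ if $a\neq0$ in $A1$. Either $A2(a)$: $n_{\mathrm{dp}}$ takes values in $\mathbb{Z}$ and $(n_{\mathrm{dp}}-n_0\mid n=n_0)=O_p(a_{n_0})$; or $A2(b)$: for all positive integers $n_0$, $(n-n_0\mid n_{\mathrm{dp}}=n_0)=O_p(a_{n_0})$. *)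

(* Defs.v *)
From HB Require Import structures.
From mathcomp Require Import all_boot all_order all_algebra.
From mathcomp Require Import all_classical all_reals all_analysis.

Set Implicit Arguments.
Unset Strict Implicit.
Unset Printing Implicit Defensive.

Import Order.TTheory GRing.Theory Num.Theory.
Import numFieldNormedType.Exports.

Local Open Scope classical_set_scope.
Local Open Scope ring_scope.

Definition measure_matrix_display : measure_display -> measure_display.
Proof. exact. Qed.

(* Product sigma-algebra on matrices, as the library does for tuples; for
   vectors over a realType it is the Borel sigma-algebra. *)
Section measurable_matrix.
Context {dT : measure_display} {T : measurableType dT}.
Variables m n : nat.

Definition matrix_cylinder : set (set 'M[T]_(m, n)) :=
  [set B | exists i j, exists2 A : set T,
     measurable A & B = (fun v : 'M[T]_(m, n) => v i j) @^-1` A].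

Let matrix_set0 : <<s matrix_cylinder >> set0.
Proof. exact: sigma_algebra0. Qed.

Let matrix_setC A : <<s matrix_cylinder >> A -> <<s matrix_cylinder >> (~` A).
Proof. exact: sigma_algebraC. Qed.

Let matrix_bigcup (F : _^nat) : (forall i, <<s matrix_cylinder >> (F i)) ->
  <<s matrix_cylinder >> (\bigcup_i (F i)).
Proof. exact: sigma_algebra_bigcup. Qed.

HB.instance Definition _ := @isMeasurable.Build (measure_matrix_display dT)
  'M[T]_(m, n) <<s matrix_cylinder >> matrix_set0 matrix_setC matrix_bigcup.

Lemma measurable_coord i j : measurable_fun [set: 'M[T]_(m, n)]
  ((fun v => v i j) : 'M[T]_(m, n) -> T).
Proof.
by move=> _ A mA; rewrite setTI; apply: sub_sigma_algebra; exists i, j, A.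
Qed.

Lemma measurable_fun_coordP d0 (U : measurableType d0) (f : U -> 'M[T]_(m, n)) :
  (forall i j, measurable_fun setT (fun u => f u i j : T)) ->
  measurable_fun setT f.
Proof.
move=> mf; apply: (@measurability _ _ _ _ _ _ matrix_cylinder) => //.
move=> _ [_ [i [j [A mA ->]]] <-].
by have := mf i j measurableT A mA; rewrite !setTI.
Qed.

End measurable_matrix.

Section lebesgue_rV.
Context {R : realType}.

Definition rV_cons d (xv : measurableTypeR R * 'rV[R]_d) : 'rV[R]_d.+1 :=
  row_mx (xv.1%:M : 'M[R]_1) xv.2.

Definition rV_uncons d (v : 'rV[R]_d.+1) : measurableTypeR R * 'rV[R]_d :=
  (v 0 ord0, rsubmx (v : 'rV_(1 + d))).

Lemma rV_consK d : cancel (@rV_cons d) (@rV_uncons d).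
Proof.
move=> [x v]; rewrite /rV_cons /rV_uncons (@row_mxKr _ 1 1 d); congr pair => /=.
have -> : ord0 = lshift d (ord0 : 'I_1) by apply: val_inj.
by rewrite (@row_mxEl _ 1 1 d) mxE eqxx mulr1n.
Qed.

Lemma measurable_rV_cons d : measurable_fun setT (@rV_cons d).
Proof.
apply: measurable_fun_coordP => i j.
rewrite /rV_cons; case: (split_ordP (j : 'I_(1 + d))) => k -> /=.
- rewrite (_ : (fun _ => _) = fst); first exact: measurable_fst.
  by apply/funext => xv; rewrite (@row_mxEl _ 1 1 d) !ord1 mxE eqxx mulr1n.
- rewrite (_ : (fun _ => _) = (fun v : 'rV[R]_d => v i k : R) \o snd); last first.
    by apply/funext => xv /=; rewrite (@row_mxEr _ 1 1 d).
  by apply: measurableT_comp => //; exact: measurable_coord.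
Qed.

Lemma measurable_rV_uncons d : measurable_fun setT (@rV_uncons d).
Proof.
apply: measurable_fun_pair; first exact: measurable_coord.
apply: measurable_fun_coordP => i j.
rewrite (_ : (fun _ => _) = (fun v : 'rV[R]_d.+1 => v i (rshift 1 j) : R)).
  exact: measurable_coord.
by apply/funext => v; rewrite mxE.
Qed.

Lemma rV_unconsK d : cancel (@rV_uncons d) (@rV_cons d).
Proof.
move=> v; apply/rowP => j; rewrite /rV_cons /rV_uncons /=.
case: (split_ordP (j : 'I_(1 + d))) => k ->.
- rewrite (@row_mxEl _ 1 1 d) !ord1 mxE eqxx mulr1n; congr (v _ _); exact: val_inj.
- by rewrite (@row_mxEr _ 1 1 d) mxE.
Qed.

Section product_rV_cons.
Variables (nu : {sigma_finite_measure set (measurableTypeR R) -> \bar R})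
  (d : nat) (mu : {sigma_finite_measure set 'rV[R]_d -> \bar R}).

Definition product_rV_cons : set 'rV[R]_d.+1 -> \bar R :=
  pushforward (nu \x mu)%E (@rV_cons d).

Let product_rV_cons0 : product_rV_cons set0 = 0%E.
Proof. by rewrite /product_rV_cons /pushforward preimage_set0 measure0. Qed.

Let product_rV_cons_ge0 A : (0 <= product_rV_cons A)%E.
Proof. by rewrite /product_rV_cons /pushforward measure_ge0. Qed.

Let product_rV_cons_sigma_additive : semi_sigma_additive product_rV_cons.
Proof.
pose m := measure_function_pushforward__canonical__measure_function_Measure
  (nu \x mu)%E (@measurable_rV_cons d).
exact: (@measure_semi_sigma_additive _ _ _ m).
Qed.

HB.instance Definition _ := isMeasure.Build _ _ _ product_rV_cons
  product_rV_cons0 product_rV_cons_ge0 product_rV_cons_sigma_additive.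

Let product_rV_cons_sigma_finite : sigma_finite setT product_rV_cons.
Proof.
have /sigma_finiteP[F [FT ndF Foo]] := sigma_finiteT nu.
have /sigma_finiteP[G [GT ndG Goo]] := sigma_finiteT mu.
exists (fun n => @rV_uncons d @^-1` (F n `*` G n)).
  apply/esym/seteqP; split=> // v _.
  have [i _ Fi] : (\bigcup_n F n) (@rV_uncons d v).1 by rewrite -FT.
  have [j _ Gj] : (\bigcup_n G n) (@rV_uncons d v).2 by rewrite -GT.
  exists (maxn i j) => //; split.
  - by move: Fi; apply/subsetPset/ndF/leq_maxl.
  - by move: Gj; apply/subsetPset/ndG/leq_maxr.
move=> n; have [mF Fn] := Foo n; have [mG Gn] := Goo n; split.
  rewrite -[X in measurable X]setTI; apply: measurable_rV_uncons => //.
  exact: measurableX.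
rewrite /product_rV_cons /pushforward -comp_preimage.
rewrite (_ : _ \o _ = id) ?preimage_id//; last first.
  by apply/funext => xv /=; rewrite rV_consK.
by rewrite product_measure1E// lte_mul_pinfty// ge0_fin_numE.
Qed.

HB.instance Definition _ := Measure_isSigmaFinite.Build _ _ _ product_rV_cons
  product_rV_cons_sigma_finite.

End product_rV_cons.

(* Lebesgue measure on R^d, as the d-fold product of the one on R; R^0 is a
   point of mass 1. *)
Fixpoint lebesgue_rV d : {sigma_finite_measure set 'rV[R]_d -> \bar R} :=
  match d return {sigma_finite_measure set 'rV[R]_d -> \bar R} with
  | 0 => \d_(0 : 'rV[R]_0)
  | d'.+1 => product_rV_cons lebesgue_measure (lebesgue_rV d')
  end.

End lebesgue_rV.

Section distances.
Context {R : realType} {m : nat}.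
Implicit Types P Q : set 'rV[R]_m -> \bar R.

(* Sides may be open, closed, half-open, unbounded or degenerate. *)
Definition rectangle : set (set 'rV[R]_m) :=
  [set S | exists I : 'I_m -> interval R, S = [set v : 'rV[R]_m | forall i, v 0 i \in I i]].

Definition KS P Q : \bar R := ereal_sup [set `|P S - Q S|%E | S in rectangle].

Definition TV P Q : \bar R :=
  ereal_sup [set `|P S - Q S|%E | S in measurable].

End distances.

Section limit_laws.
Context {R : realType} {d : nat}.

Definition cvg_in_distribution (P : nat -> set 'rV[R]_d -> \bar R)
    (X : set 'rV[R]_d -> \bar R) : Prop :=
  forall f : 'rV[R]_d -> R, continuous f -> (exists C : R, forall v, `|f v| <= C) ->
    (fun n => \int[P n]_v (f v)%:E)%E @ \oo --> (\int[X]_v (f v)%:E)%E.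

(* "Continuous random variable" is read as: it has a Lebesgue density. *)
Definition continuous_law (X : set 'rV[R]_d -> \bar R) : Prop :=
  exists f : 'rV[R]_d -> R,
    [/\ measurable_fun setT f, forall v, 0 <= f v &
        forall S, measurable S -> X S = (\int[lebesgue_rV d]_(v in S) (f v)%:E)%E].

Definition mean_zero (X : probability 'rV[R]_d R) : Prop :=
  forall i, X.-integrable setT (fun v : 'rV[R]_d => (v 0 i)%:E) /\
    (\int[X]_v (v 0 i)%:E = 0)%E.

(* Y n = O_p(c n), where L n is the law of the real random variable Y n. *)
Definition bigOp (L : nat -> set R -> \bar R) (c : nat -> R) : Prop :=
  forall eps : R, 0 < eps -> exists C : R,
    \forall n \near \oo, (L n [set y | (C * `|c n| < `|y|)%R] <= eps%:E)%E.

End limit_laws.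

(* The parameter, sample size, dataset, private summary and private sample size.
   A dataset of size n is an n-tuple of records in T.  Kernels in theta are
   extended arbitrarily from the parameter set to R^p, and families indexed by
   the sample size arbitrarily from n >= 1 to all n; only n >= 1 is ever used.
   The priors need not be normalized.  The countable family of laws of the
   private sample size always has a common dominating measure, so asking for
   densities is no restriction; they are needed to condition on a value of
   n_dp by Bayes' rule. *)
Record dp_model (R : realType) (p d : nat) (dT : measure_display)
    (T : measurableType dT) := DPModel {
  Theta : set 'rV[R]_p ;
  measurable_Theta : measurable Theta ;
  prior : {measure set 'rV[R]_p -> \bar R} ;
  prior_Theta : prior (~` Theta) = 0%E ;
  size_prior : nat -> R ;
  size_prior_ge0 : forall n, 0 <= size_prior n ;
  data_ker : forall n, R.-pker 'rV[R]_p ~> (n.-tuple T) ;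
  summary_ker : forall n, R.-pker (n.-tuple T) ~> 'rV[R]_d ;
  ndp_law : nat -> probability (measurableTypeR R) R ;
  ndp_ref : {sigma_finite_measure set (measurableTypeR R) -> \bar R} ;
  ndp_dens : nat -> R -> R ;
  measurable_ndp_dens : forall n, measurable_fun setT (ndp_dens n) ;
  ndp_dens_ge0 : forall n y, 0 <= ndp_dens n y ;
  ndp_lawE : forall n (A : set (measurableTypeR R)), measurable A ->
    ndp_law n A = (\int[ndp_ref]_(y in A) (ndp_dens n y)%:E)%E }.

Section model.
Context {R : realType} {p d : nat} {dT : measure_display} {T : measurableType dT}.
Variable M : dp_model R p d T.
Implicit Types (n k : nat) (theta : 'rV[R]_p) (y a b : R).

Definition proper_prior : Prop := prior M setT = 1%E.

(* p(s | theta, n) = \int p(s | x) p(x | theta, n) dx *)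
Definition s_law n theta : {measure set 'rV[R]_d -> \bar R} :=
  mkcomp_noparam (data_ker M n) (summary_ker M n) theta.

(* m^b (m^-a s - g) for a real m; powR takes its junk values at m <= 0. *)
Definition standardize a b m (g s : 'rV[R]_d) : 'rV[R]_d :=
  (m `^ b) *: ((m `^ (- a)) *: s - g).

(* p(n^b (n^-a s - g(theta)) | theta, n) *)
Definition std_n_law a b (g : 'rV[R]_p -> 'rV[R]_d) n theta :
    set 'rV[R]_d -> \bar R :=
  pushforward (s_law n theta) (standardize a b n%:R (g theta)).

(* p(n_dp^b (n_dp^-a s - g(theta)) | theta, n): given (theta, n), s and n_dp
   are independent. *)
Definition std_ndp_law a b (g : 'rV[R]_p -> 'rV[R]_d) n theta :
    set 'rV[R]_d -> \bar R :=
  pushforward (s_law n theta \x ndp_law M n)%E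
    (fun sm => standardize a b sm.2 (g theta) sm.1).

(* The law of (theta, V) in R^(p + d), for theta drawn from the prior and V
   from K theta. *)
Definition joint_law (K : 'rV[R]_p -> set 'rV[R]_d -> \bar R) :
    set 'rV[R]_(p + d) -> \bar R :=
  fun S => (\int[prior M]_(theta in Theta M)
    K theta [set v | S (row_mx theta v)])%E.

Definition evidence y : \bar R :=
  (\sum_(1 <= k <oo) (ndp_dens M k y * size_prior M k)%:E)%E.

(* p(n = k | n_dp = y), for k >= 1 *)
Definition posterior y k : R :=
  ndp_dens M k y * size_prior M k / fine (evidence y).

(* The law given n_dp = y, from the laws L k given n = k. *)
Definition given_ndp U (L : nat -> set U -> \bar R) y : set U -> \bar R :=
  fun S => (\sum_(1 <= k <oo) (posterior y k)%:E * L k S)%E.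

Definition A1 a b (g : 'rV[R]_p -> 'rV[R]_d) : Prop :=
  [/\ 0 < b, b <= 1 & forall theta, Theta M theta ->
    exists X : probability 'rV[R]_d R, [/\ continuous_law X, mean_zero X &
      cvg_in_distribution (fun n => std_n_law a b g n theta) X]].

Definition A1' a b (g : 'rV[R]_p -> 'rV[R]_d) : Prop :=
  [/\ 0 < b, b <= 1 & forall theta, Theta M theta ->
    exists X : probability 'rV[R]_d R, [/\ continuous_law X, mean_zero X &
      (fun n => TV (std_n_law a b g n theta) X) @ \oo --> 0%E]].

Definition A2_rate a b (c : nat -> R^o) : Prop :=
  if a == 0 then c =o_\oo (fun n => n%:R : R^o)
  else c =o_\oo (fun n => n%:R `^ (1 - b) : R^o).

Definition A2a a b (c : nat -> R) : Prop :=
  [/\ A2_rate a b c,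
      forall n, (1 <= n)%N -> ndp_law M n (range (fun z : int => z%:~R)) = 1%E &
      bigOp (fun n => pushforward (ndp_law M n) (fun m => m - n%:R)) c].

(* The second clause says that p(n | n_dp = n_0) is well defined. *)
Definition A2b a b (c : nat -> R) : Prop :=
  [/\ A2_rate a b c,
      forall n0, (1 <= n0)%N -> (0 < evidence n0%:R < +oo)%E &
      bigOp (fun n0 => given_ndp (fun k => \d_(k%:R - n0%:R : R)) n0%:R) c].

End model.

(* Main.v *)
(** Fix [theta] and write U_n = n^b (n^-a s - g(theta)), with limit law X.  For
   real m, n > 0, standardizing with m instead of n gives alpha U_n + beta with
   alpha = (m/n)^(b-a) and beta = m^b ((m/n)^-a - 1) g(theta), and the rate in
   A2 forces alpha -> 1, beta -> 0 uniformly over |m - n| <= C |c_n|.  Both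
   distances are suprema over a class of sets stable under affine preimages, so
   everything reduces to two facts about X:
   - TV(alpha X + beta, X) -> 0 as (alpha, beta) -> (1, 0).  This only uses that
     X has a density: the uniform bound
     lambda(A /\ T^-1 S) <= lambda(A /\ S) + e for all S
     is explicit for intervals A, passes to all measurable A by the pi-lambda
     theorem and to products by Tonelli, and then to densities by approximation
     with simple functions;
   - convergence in distribution to X is uniform over rectangles (Polya): after
     composition with the continuous marginal distribution functions of X,
     indicators of rectangles are bracketed by finitely many continuous
     functions.
   The laws given n_dp are mixtures over m = n_dp or over k = n, and the mixing
   law gives small mass to |m - n| > C |c_n|.  The joint statements follow by
   dominated convergence over theta; there g is measurable on Theta because
   n^-a s -> g(theta) in probability. *)

From HB Require Import structures.
Require Import Defs.
From mathcomp Require Import all_boot all_order all_algebra.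
From mathcomp Require Import all_classical all_reals all_analysis.
From mathcomp Require Import measurable_realfun ring lra.

Set Implicit Arguments.
Unset Strict Implicit.
Unset Printing Implicit Defensive.

Import Order.TTheory GRing.Theory Num.Theory.
Import numFieldNormedType.Exports.
Local Open Scope classical_set_scope.
Local Open Scope ring_scope.

(** * Sets almost invariant under a family of maps *)

(** The two rates in A2 come from the shift: [beta] is about [- a n^(b-1) (m - n) g(theta)], which
    tends to 0 when [m - n = o(n^(1-b))]. For [a = 0] there is no shift, and the slope only needs
    [m / n -> 1], that is [m - n = o(n)]. In the total variation bound [S] is arbitrary, so no
    regularity of [S] can be exploited. The estimate is therefore stated for pairs [A], [S]: uniform
    over [S], while approximation arguments act on [A] alone. For rectangles the grid is laid on the
    levels of the marginal distribution functions rather than in space. Unbounded rectangles then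
    need no tightness argument, and the mass of a grid cell is known in advance. In part 2 the laws
    of [s] for sizes [k] and [n] are each close to [X] only on their own scale, so a set has to be
    carried from the scale of [n] to that of [k] before the two can be compared. KS and TV differ
    only in the class of sets, so most of the argument is carried out for an abstract class [SS]
    stable under affine preimages. *)

Section asymptotically_invariant.
Context d (X : measurableType d) (R : realType) (mu : {measure set X -> \bar R}).
Context (J : Type) (F : set_system J) {FF : Filter F} (T : J -> X -> X).
Hypothesis mT : forall j, measurable_fun setT (T j).
Local Open Scope ereal_scope.

(** One inequality suffices: passing to the complement of [S] gives the other one when [A] has
    finite mass. *)
Definition asymptotically_invariant (A : set X) :=
  forall e : R, (0 < e)%R -> \forall j \near F, forall S, measurable S ->
    mu (A `&` T j @^-1` S) <= mu (A `&` S) + e%:E.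

Lemma measurable_preimageT j S : measurable S -> measurable (T j @^-1` S).
Proof. by move=> mS; rewrite -[X in measurable X]setTI; exact: mT. Qed.
Local Hint Resolve measurable_preimageT : core.

Lemma sub_finite_measure (A B : set X) : measurable A -> measurable B ->
  A `<=` B -> mu B < +oo -> mu A \is a fin_num.
Proof.
move=> mA mB AB Boo; rewrite ge0_fin_numE//.
by apply: le_lt_trans Boo; rewrite le_measure ?inE.
Qed.

Lemma asymptotically_invariant_ge (A : set X) : measurable A -> mu A < +oo ->
  asymptotically_invariant A -> forall e : R, (0 < e)%R ->
  \forall j \near F, forall S, measurable S ->
    mu (A `&` S) <= mu (A `&` T j @^-1` S) + e%:E.
Proof.
move=> mA Aoo invA e e0; apply: filterS (invA e e0) => j hA S mS.
have mTS := measurable_preimageT j mS.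
have := hA _ (measurableC mS).
have split_A B : measurable B -> mu A = mu (A `&` ~` B) + mu (A `&` B).
  by move=> mB; rewrite -setDE -measureDI.
have := split_A _ mTS; rewrite (split_A _ mS) preimage_setC.
have f B : measurable B -> exists r : R, mu (A `&` B) = r%:E.
  move=> mB; exists (fine (mu (A `&` B))); rewrite fineK//.
  by apply: (@sub_finite_measure _ A) => //; exact: measurableI.
have [r1 ->] := f _ mS; have [r2 ->] := f _ (measurableC mS).
have [r3 ->] := f _ mTS; have [r4 ->] := f _ (measurableC mTS).
rewrite -!EFinD !lee_fin => -[h1] h2; lra.
Qed.

(** Mass on the difference is a subtraction, so it takes the bound for [A] together with the
    reversed bound for [B]. *)
Lemma asymptotically_invariantD (A B : set X) : measurable A -> measurable B ->
  mu A < +oo -> B `<=` A -> asymptotically_invariant A ->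
  asymptotically_invariant B -> asymptotically_invariant (A `\` B).
Proof.
move=> mA mB Aoo BA invA invB e e0; have e20 : (0 < e / 2)%R by rewrite divr_gt0.
have Boo : mu B < +oo by rewrite -ge0_fin_numE//; exact: (@sub_finite_measure _ A).
have geB := asymptotically_invariant_ge mB Boo invB e20.
apply: filterS2 (invA _ e20) geB => j hA hB S mS.
have mTS := measurable_preimageT j mS; have := hB _ mS; have := hA _ mS.
have f C : measurable C -> mu (A `&` C) = mu (B `&` C) + mu ((A `\` B) `&` C).
  move=> mC; have -> : B `&` C = (A `&` C) `&` B by rewrite setIAC (setIidr BA).
  have -> : (A `\` B) `&` C = (A `&` C) `\` B by rewrite !setDE setIAC.
  by rewrite addeC -measureDI//; exact: measurableI.
have g C : measurable C -> exists r1 r2 : R,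
    mu (B `&` C) = r1%:E /\ mu ((A `\` B) `&` C) = r2%:E.
  move=> mC; exists (fine (mu (B `&` C))), (fine (mu ((A `\` B) `&` C))).
  have mBC : measurable (B `&` C) by exact: measurableI.
  have mABC : measurable ((A `\` B) `&` C).
    by apply: measurableI => //; exact: measurableD.
  split; rewrite fineK//.
    by apply: (@sub_finite_measure _ A) => // x [/BA].
  by apply: (@sub_finite_measure _ A) => // x [[]].
rewrite (f _ mS) (f _ mTS).
have [r1 [r2 [-> ->]]] := g _ mS; have [r3 [r4 [-> ->]]] := g _ mTS.
by rewrite -!EFinD !lee_fin => h1 h2; lra.
Qed.

(** A single [A n] carries all but [e / 2] of the finite mass, and this remainder costs at most
    [e / 2] whatever [S] is. *)
Lemma asymptotically_invariant_bigcup (A : (set X)^nat) :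
  (forall n, measurable (A n)) -> nondecreasing_seq A ->
  mu (\bigcup_n A n) < +oo -> (forall n, asymptotically_invariant (A n)) ->
  asymptotically_invariant (\bigcup_n A n).
Proof.
move=> mA ndA Uoo invA e e0; have e20 : (0 < e / 2)%R by rewrite divr_gt0.
have mU : measurable (\bigcup_n A n) by exact: bigcupT_measurable.
have [n Un] : exists n, mu (\bigcup_n A n `\` A n) <= (e / 2)%:E.
  have Ufin : mu (\bigcup_n A n) \is a fin_num by rewrite ge0_fin_numE.
  have AU k : A k `<=` \bigcup_n A n by move=> x; exists k.
  have : mu (A n) @[n --> \oo] --> mu (\bigcup_n A n) by exact: nondecreasing_cvg_mu.
  rewrite -(fineK Ufin) => /fine_cvgP[_].
  move=> /cvgrPdist_le/(_ _ e20)[n _ /(_ _ (leqnn n))] h; exists n.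
  have -> : mu (\bigcup_n A n `\` A n) = mu (\bigcup_n A n) - mu (A n).
    by rewrite measureD// (setIidr (AU n)).
  have Afin : mu (A n) \is a fin_num by exact: (@sub_finite_measure _ (\bigcup_n A n)).
  move: h; rewrite -(fineK Ufin) -(fineK Afin) -EFinB lee_fin /= => h.
  by apply: le_trans h; exact: ler_norm.
apply: filterS (invA n _ e20) => j hA S mS.
have mTS := measurable_preimageT j mS.
apply: (@le_trans _ _ (mu (A n `&` T j @^-1` S) + (e / 2)%:E)).
  apply: (@le_trans _ _ (mu ((A n `&` T j @^-1` S) `|` (\bigcup_n A n `\` A n)))).
    rewrite le_measure ?inE//; first exact: measurableI.
      by apply: measurableU; [exact: measurableI|exact: measurableD].
    by move=> x [Ux Tx]; have [Ax|Ax] := pselect (A n x); [left|right].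
  apply: (le_trans (measureU2 _ _ _)).
  - exact: measurableI.
  - exact: measurableD.
  - by rewrite leeD2l.
have -> : e%:E = (e / 2)%:E + (e / 2)%:E by rewrite -EFinD -splitr.
rewrite addeA leeD2r//; apply: (@le_trans _ _ (mu (A n `&` S) + (e / 2)%:E)).
  exact: hA.
rewrite leeD2r// le_measure ?inE//; [exact: measurableI|exact: measurableI|].
by apply: setSI => x; exists n.
Qed.

(** Intersecting with [E] keeps all masses finite, which closure under differences and increasing
    unions requires. *)
Lemma asymptotically_invariant_dynkin (G : set (set X)) (E : set X) :
  d.-measurable = <<s G >> -> setI_closed G -> measurable E -> mu E < +oo ->
  asymptotically_invariant E -> (forall A, G A -> asymptotically_invariant (E `&` A)) ->
  forall A, measurable A -> asymptotically_invariant (E `&` A).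
Proof.
move=> mG GI mE Eoo invE invG A mA.
pose H := [set A | measurable A /\ asymptotically_invariant (E `&` A)].
suff : H A by case.
have EAoo B : measurable B -> mu (E `&` B) < +oo.
  move=> mB; rewrite -ge0_fin_numE//; apply: (@sub_finite_measure _ E) => //.
  exact: measurableI.
have H_lambda : lambda_system setT H.
  split => //.
  - by split; [exact: measurableT|rewrite setIT].
  - move=> B C CB [mB invB] [mC invC]; split; first exact: measurableD.
    rewrite (_ : _ `&` _ = (E `&` B) `\` (E `&` C)); last first.
      apply/seteqP; split=> [x [Ex [Bx Cx]]|x [[Ex Bx] ECx]].
        by split=> // -[].
      by split=> //; split=> // Cx; exact: ECx.
    apply: asymptotically_invariantD => //; try exact: measurableI.
      exact: EAoo.
    exact: setIS.
  - move=> B ndB HB; split; first by apply: bigcupT_measurable => n; case: (HB n).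
    rewrite setI_bigcupr; apply: asymptotically_invariant_bigcup => //.
    + by move=> n; apply: measurableI => //; case: (HB n).
    + by move=> m n mn; apply/subsetPset; apply: setIS; exact/subsetPset/ndB.
    + by rewrite -setI_bigcupr; apply/EAoo/bigcupT_measurable => n; case: (HB n).
    + by move=> n; case: (HB n).
have : <<s G >> `<=` H.
  apply: lambda_system_subset => //.
  by move=> B GB; split; [rewrite mG; exact: sub_sigma_algebra|exact: invG].
by apply; rewrite -mG.
Qed.

End asymptotically_invariant.

(** * Affine maps on the line *)

(** By uniqueness of Lebesgue measure: [a] times its image under the map has the same values on
    half-open intervals. *)
Lemma lebesgue_measure_affine (R : realType) (a b : R)
    (A : set (measurableTypeR R)) : 0 < a -> measurable A ->
  lebesgue_measure ((fun x : R => a * x + b) @^-1` A) =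
  ((a^-1)%:E * lebesgue_measure A)%E.
Proof.
move=> a0 mA; pose T (x : measurableTypeR R) : measurableTypeR R := a * x + b.
have mT : measurable_fun setT T.
  by apply: measurable_funD => //; exact: measurable_funM.
pose nu := measure_function_pushforward__canonical__measure_function_Measure
  (@lebesgue_measure R) mT.
pose m := mscale (NngNum (ltW a0)) nu.
suff /(_ A mA) -> : forall A, measurable A -> lebesgue_measure A = m A.
  by rewrite /m /mscale /= muleA -EFinM mulVf ?gt_eqF// mul1e.
apply: lebesgue_measure_unique => X /ocitvP[->|[[u v] /= uv ->]].
  by rewrite !measure0.
rewrite /m /mscale /= /pushforward.
rewrite (_ : T @^-1` _ = `](u - b) / a, (v - b) / a]%classic); last first.
  apply/seteqP; split=> x /=; rewrite !in_itv /= /T ltr_pdivrMr// ler_pdivlMr//;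
    by rewrite ltrBlDr lerBrDr [x * a]mulrC.
rewrite !lebesgue_measure_itv /= !lte_fin uv ltr_pM2r ?invr_gt0// ltrD2r uv.
rewrite -!EFinB -EFinM; congr (_%:E); field; exact: lt0r_neq0.
Qed.

Section affine_line.
Context (R : realType) (J : Type) (F : set_system J) {FF : Filter F}.
Variables (a b : J -> R).
Hypotheses (a1 : a @ F --> (1 : R)) (b0 : b @ F --> (0 : R)).
Let T j (x : measurableTypeR R) : measurableTypeR R := a j * x + b j.

Let mT j : measurable_fun setT (T j).
Proof. by apply: measurable_funD => //; exact: measurable_funM. Qed.

Lemma asymptotically_invariant_itv (u v : R) :
  asymptotically_invariant (@lebesgue_measure R) F T `]u, v]%classic.
Proof.
move=> e e0; have [vu|uv] := leP v u.
  apply: filterE => j S mS; rewrite set_itv_ge; last by rewrite bnd_simp -leNgt.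
  by rewrite !set0I measure0 add0e lee_fin ltW.
(* The image of the interval exceeds it by at most the two segments joining each endpoint to its
   image; [eta j] is their total length. *)
pose eta j := `|a j * u + b j - u| + `|a j * v + b j - v|.
have aV : (fun j => (a j)^-1) @ F --> (1 : R).
  by rewrite -[X in _ --> X]invr1; apply: cvgV.
have pt w : (fun j => `|a j * w + b j - w|) @ F --> (0 : R).
  rewrite -[X in _ --> X](@normr0 _ R); apply: cvg_norm.
  rewrite [X in _ --> X](_ : _ = 1 * w + 0 - w); last by rewrite mul1r addr0 subrr.
  by apply: cvgB; [apply: cvgD => //; exact: cvgMl|exact: cvg_cst].
(* The whole error: with [r] the measure of [A] meet [S], it bounds [a^-1 (r + eta) - r], as
   [0 <= r <= v - u]. *)
have small : (fun j => `|(a j)^-1 - 1| * (v - u) + (a j)^-1 * eta j) @ F --> (0 : R).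
  rewrite [X in _ --> X](_ : _ = `|1 - 1| * (v - u) + 1 * (0 + 0)); last first.
    by rewrite subrr normr0 mul0r addr0 mulr0 addr0.
  apply: cvgD; last by apply: cvgM => //; exact: cvgD.
  by apply: cvgMl; apply: cvg_norm; apply: cvgB => //; exact: cvg_cst.
have a_gt0 : \forall j \near F, 0 < a j by apply: (cvgr_gt 1).
have small_e : \forall j \near F, `|(a j)^-1 - 1| * (v - u) + (a j)^-1 * eta j < e.
  exact: (cvgr_lt 0).
apply: filterS2 a_gt0 small_e => j a_gt0 small_e S mS.
pose A : set (measurableTypeR R) := `]u, v]%classic.
pose TA : set (measurableTypeR R) := `]a j * u + b j, a j * v + b j]%classic.
have mA : measurable A by exact: measurable_itv.
have mTA : measurable TA by exact: measurable_itv.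
have TTA : T j @^-1` TA = A.
  by apply/seteqP; split=> x;
    rewrite /TA /A /= !in_itv /= /T ltrD2r lerD2r ltr_pM2l// ler_pM2l.
have aff B : measurable B -> lebesgue_measure (T j @^-1` B) =
    ((a j)^-1%:E * lebesgue_measure B)%E.
  by move=> mB; exact: lebesgue_measure_affine.
(* Writing [A] as the preimage of its image [TA] makes the left side the measure of a preimage of
   [TA] meet [S], computed by scaling. *)
suff : (lebesgue_measure (A `&` T j @^-1` S) <= lebesgue_measure (A `&` S) + e%:E)%E by [].
rewrite -[in X in (X <= _)%E]TTA -preimage_setI aff; last exact: measurableI.
have mAS : measurable (A `&` S) by exact: measurableI.
have AS_le : (lebesgue_measure (A `&` S) <= (v - u)%:E)%E.
  apply: (@le_trans _ _ (lebesgue_measure A)); first by rewrite le_measure ?inE.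
  by rewrite lebesgue_measure_itv /= lte_fin uv EFinB.
have : (lebesgue_measure (TA `&` S) <= lebesgue_measure (A `&` S) + (eta j)%:E)%E.
  pose hull (x y : R) : set (measurableTypeR R) := `[Num.min x y, Num.max x y]%classic.
  have mhull x y : measurable (hull x y) by exact: measurable_itv.
  have hullE x y : lebesgue_measure (hull x y) = (`|x - y|%:E)%E.
    rewrite lebesgue_measure_itv /= lte_fin.
    case: (ltgtP x y) => [xy|xy|->]; rewrite ?ltxx ?subrr ?normr0//.
      by rewrite ltr0_norm ?subr_lt0// opprB EFinB ?xy.
    by rewrite gtr0_norm ?subr_gt0// EFinB ?xy.
  rewrite EFinD -!hullE.
  apply: (@le_trans _ _ (lebesgue_measure ((A `&` S) `|`
    (hull (a j * u + b j) u `|` hull (a j * v + b j) v)))).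
    rewrite le_measure ?inE//; first exact: measurableI.
      by apply: measurableU => //; exact: measurableU.
    move=> x [TAx Sx]; have [Ax|Ax] := pselect (A x); first by left.
    right; move: TAx Ax; rewrite /TA /A /hull /= !in_itv /= => /andP[x1 x2] /negP.
    rewrite negb_and -leNgt -ltNge => /orP[xu|xv]; [left|right]; apply/andP.
      by split; rewrite ?ge_min ?le_max ?(ltW x1) ?xu ?orbT.
    by split; rewrite ?ge_min ?le_max ?x2 ?(ltW xv) ?orbT.
  apply: (le_trans (measureU2 _ _ _)) => //; first exact: measurableU.
  by rewrite leeD2l//; exact: measureU2.
have AS_fin : lebesgue_measure (A `&` S) \is a fin_num.
  by rewrite ge0_fin_numE//; apply: (le_lt_trans AS_le); rewrite ltry.
move: AS_le; rewrite -(fineK AS_fin) => AS_le TAS_le.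
have TAS_fin : lebesgue_measure (TA `&` S) \is a fin_num.
  by rewrite ge0_fin_numE//; apply: (le_lt_trans TAS_le); rewrite -EFinD ltry.
have AS_ge0 : 0 <= fine (lebesgue_measure (A `&` S)) by exact: fine_ge0.
move: AS_le TAS_le AS_ge0; rewrite -(fineK TAS_fin) -EFinM -!EFinD !lee_fin.
set r := fine (lebesgue_measure (A `&` S)); set s := fine _ => r_le s_le r_ge0.
have h1 : (a j)^-1 * s <= (a j)^-1 * (r + eta j) by rewrite ler_pM2l// invr_gt0.
have h2 : ((a j)^-1 - 1) * r <= `|(a j)^-1 - 1| * (v - u).
  apply: (@le_trans _ _ (`|(a j)^-1 - 1| * r)); last by rewrite ler_wpM2l.
  by rewrite ler_wpM2r// ler_norm.
by move: h1 h2 small_e; lra.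
Qed.

Lemma asymptotically_invariant_lebesgue_measure (A : set (measurableTypeR R)) :
  measurable A -> (lebesgue_measure A < +oo)%E ->
  asymptotically_invariant (@lebesgue_measure R) F T A.
Proof.
(* The pi-lambda argument needs an ambient set of finite measure, hence the exhaustion by bounded
   intervals. *)
move=> mA Aoo; pose E n : set (measurableTypeR R) := `]- n%:R, n%:R]%classic.
have mE n : measurable (E n) by exact: measurable_itv.
have AE : A = \bigcup_n (E n `&` A).
  rewrite -setI_bigcupl (_ : \bigcup_n E n = setT) ?setTI//.
  apply/seteqP; split=> // x _; exists (Num.truncn `|x|).+1 => //=.
  rewrite /E /= in_itv /=; have := truncnS_gt `|x|; rewrite ltr_norml => /andP[-> h].
  exact: ltW.
rewrite AE; apply: asymptotically_invariant_bigcup => //.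
- by move=> n; exact: measurableI.
- move=> m n mn; apply/subsetPset; apply: setSI => x; rewrite /E /= !in_itv /=.
  have mnR : m%:R <= n%:R :> R by rewrite ler_nat.
  by move=> /andP[x1 x2]; apply/andP; split; lra.
- by rewrite -AE.
- move=> n; have Eoo : (lebesgue_measure (E n) < +oo)%E.
    by rewrite lebesgue_measure_itv /=; case: ifP => // _; rewrite -EFinB ltry.
  have := @asymptotically_invariant_dynkin _ _ R (@lebesgue_measure R) J F FF T
    mT (@ocitv R) (E n); apply => //.
  + exact: ocitvI.
  + exact: asymptotically_invariant_itv.
  + move=> B ocB; have /ocitvP[->|[[u v] _ ->]] : ocitv (E n `&` B).
      by apply: ocitvI => //; exact: is_ocitv.
      rewrite -(set_itvoc0 (0 : R)); exact: asymptotically_invariant_itv.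
    exact: asymptotically_invariant_itv.
Qed.

End affine_line.

(** * Products and affine maps on row vectors *)

Section product_asymptotically_invariant.
Context d1 d2 (X1 : measurableType d1) (X2 : measurableType d2) (R : realType).
Variables (mu1 : {sigma_finite_measure set X1 -> \bar R})
  (mu2 : {sigma_finite_measure set X2 -> \bar R}).
Context (J : Type) (F : set_system J) {FF : Filter F}.
Variables (T1 : J -> X1 -> X1) (T2 : J -> X2 -> X2).
Hypotheses (mT1 : forall j, measurable_fun setT (T1 j))
  (mT2 : forall j, measurable_fun setT (T2 j)).
Local Open Scope ereal_scope.

Lemma product_measure12E (W : set (X1 * X2)) : measurable W ->
  (mu1 \x mu2) W = (mu1 \x^ mu2) W.
Proof.
by apply: product_measure_unique => A B mA mB; exact: product_measure2E.
Qed.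

Lemma product_measure1_setX (A : set X1) (B : set X2) (W : set (X1 * X2)) :
  measurable A ->
  (mu1 \x mu2) (A `*` B `&` W) = \int[mu1]_(x in A) mu2 (B `&` xsection W x).
Proof.
move=> mA; rewrite [RHS]integral_mkcond; apply: eq_integral => x _ /=.
rewrite patchE xsectionI; have [xA|xA] := boolP (x \in A).
  by rewrite in_xsectionX.
by rewrite notin_xsectionX// set0I measure0.
Qed.

Lemma product_measure2_setX (A : set X1) (B : set X2) (W : set (X1 * X2)) :
  measurable B ->
  (mu1 \x^ mu2) (A `*` B `&` W) = \int[mu2]_(y in B) mu1 (A `&` ysection W y).
Proof.
move=> mB; rewrite [RHS]integral_mkcond; apply: eq_integral => y _ /=.
rewrite patchE ysectionI; have [yB|yB] := boolP (y \in B).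
  by rewrite in_ysectionX.
by rewrite notin_ysectionX// set0I measure0.
Qed.

Lemma measurable_xsectionI (B : set X2) (W : set (X1 * X2)) :
  measurable B -> measurable W ->
  measurable_fun setT (fun x => mu2 (B `&` xsection W x)).
Proof.
move=> mB mW; rewrite (_ : (fun _ => _) = mu2 \o xsection ([set: X1] `*` B `&` W)).
  by apply: measurable_fun_xsection; apply: measurableI => //; exact: measurableX.
by apply/funext => x /=; rewrite xsectionI in_xsectionX// inE.
Qed.

Lemma measurable_ysectionI (A : set X1) (W : set (X1 * X2)) :
  measurable A -> measurable W ->
  measurable_fun setT (fun y => mu1 (A `&` ysection W y)).
Proof.
move=> mA mW; rewrite (_ : (fun _ => _) = mu1 \o ysection (A `*` [set: X2] `&` W)).
  by apply: measurable_fun_ysection; apply: measurableI => //; exact: measurableX.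
by apply/funext => y /=; rewrite ysectionI in_ysectionX// inE.
Qed.

Let T12 j (xy : X1 * X2) := (T1 j xy.1, T2 j xy.2).

Lemma measurable_map_pair j : measurable_fun setT (T12 j).
Proof. by apply: measurable_fun_pair; exact: measurableT_comp. Qed.

(* The maps T1 and T2 act one coordinate after the other, so that Tonelli
   reduces each step to a bound which is uniform over the sections of S. *)
Lemma asymptotically_invariant_setX (A : set X1) (B : set X2) :
  measurable A -> measurable B -> mu1 A < +oo -> mu2 B < +oo ->
  asymptotically_invariant mu1 F T1 A -> asymptotically_invariant mu2 F T2 B ->
  asymptotically_invariant (mu1 \x mu2) F T12 (A `*` B).
Proof.
move=> mA mB Aoo Boo invA invB e e0.
have fineA : mu1 A \is a fin_num by rewrite ge0_fin_numE.
have fineB : mu2 B \is a fin_num by rewrite ge0_fin_numE.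
(* A bound [e1] on every section integrates over [A] to at most [e / 2]; adding 1 avoids a division
   by 0. *)
pose e1 := (e / 2 / (fine (mu1 A) + 1))%R; pose e2 := (e / 2 / (fine (mu2 B) + 1))%R.
have A0 : (0 <= fine (mu1 A))%R by exact: fine_ge0.
have B0 : (0 <= fine (mu2 B))%R by exact: fine_ge0.
have e10 : (0 < e1)%R by rewrite !divr_gt0// ltr_wpDl.
have e20 : (0 < e2)%R by rewrite !divr_gt0// ltr_wpDl.
have e1A : (e1 * fine (mu1 A) <= e / 2)%R.
  by rewrite /e1 -mulrA ler_piMr ?divr_ge0 ?(ltW e0)// mulrC ler_pdivrMr; lra.
have e2B : (e2 * fine (mu2 B) <= e / 2)%R.
  by rewrite /e2 -mulrA ler_piMr ?divr_ge0 ?(ltW e0)// mulrC ler_pdivrMr; lra.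
apply: filterS2 (invA _ e20) (invB _ e10) => j hA hB S mS.
have mTS : measurable (T12 j @^-1` S).
  by rewrite -[X in measurable X]setTI; exact: measurable_map_pair.
(* The intermediate set, in which only the first coordinate is moved. *)
pose V := (fun xy : X1 * X2 => (T1 j xy.1, xy.2)) @^-1` S.
have mV : measurable V.
  rewrite -[X in measurable X]setTI; apply: measurable_fun_pair => //.
  exact: measurableT_comp.
have xT x : xsection (T12 j @^-1` S) x = T2 j @^-1` xsection S (T1 j x).
  by apply/seteqP; split=> y; rewrite /xsection /= !inE.
have xV x : xsection V x = xsection S (T1 j x).
  by apply/seteqP; split=> y; rewrite /xsection /= !inE.
have yV y : ysection V y = T1 j @^-1` ysection S y.
  by apply/seteqP; split=> x; rewrite /ysection /= !inE.
have stepB : (mu1 \x mu2) (A `*` B `&` T12 j @^-1` S) <=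
    (mu1 \x mu2) (A `*` B `&` V) + (e / 2)%:E.
  rewrite !product_measure1_setX//.
  apply: (@le_trans _ _ (\int[mu1]_(x in A) (mu2 (B `&` xsection V x) + e1%:E))).
    apply: ge0_le_integral => //.
    - by apply: measurable_funTS; exact: measurable_xsectionI.
    - apply: measurable_funTS; apply: emeasurable_funD => //.
      exact: measurable_xsectionI.
    - by move=> x _; rewrite xT xV; apply: hB; exact: measurable_xsection.
  rewrite ge0_integralD//.
  - rewrite integral_cst// leeD2l//.
    by rewrite [leLHS](_ : _ = (e1 * fine (mu1 A))%:E) ?lee_fin// (EFinM (_ : R) (fine _)) fineK.
  - by apply: measurable_funTS; exact: measurable_xsectionI.
  - by move=> x _; rewrite lee_fin ltW.
have stepA : (mu1 \x mu2) (A `*` B `&` V) <=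
    (mu1 \x mu2) (A `*` B `&` S) + (e / 2)%:E.
  have mAB : measurable (A `*` B) by exact: measurableX.
  rewrite !product_measure12E; try exact: measurableI.
  rewrite !product_measure2_setX//.
  apply: (@le_trans _ _ (\int[mu2]_(y in B) (mu1 (A `&` ysection S y) + e2%:E))).
    apply: ge0_le_integral => //.
    - by apply: measurable_funTS; exact: measurable_ysectionI.
    - apply: measurable_funTS; apply: emeasurable_funD => //.
      exact: measurable_ysectionI.
    - by move=> y _; rewrite yV; apply: hA; exact: measurable_ysection.
  rewrite ge0_integralD//.
  - rewrite integral_cst// leeD2l//.
    by rewrite [leLHS](_ : _ = (e2 * fine (mu2 B))%:E) ?lee_fin// (EFinM (_ : R) (fine _)) fineK.
  - by apply: measurable_funTS; exact: measurable_ysectionI.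
  - by move=> x _; rewrite lee_fin ltW.
apply: (le_trans stepB); rewrite [in leRHS](splitr e) EFinD addeA.
by rewrite leeD2r.
Qed.

(** Boxes of finite measure exhaust [W]; inside one box the measurable rectangles form a generating
    pi-system. *)
Lemma asymptotically_invariant_product :
  (forall A, measurable A -> mu1 A < +oo -> asymptotically_invariant mu1 F T1 A) ->
  (forall B, measurable B -> mu2 B < +oo -> asymptotically_invariant mu2 F T2 B) ->
  forall W, measurable W -> (mu1 \x mu2) W < +oo ->
  asymptotically_invariant (mu1 \x mu2) F T12 W.
Proof.
move=> inv1 inv2 W mW Woo.
have /sigma_finiteP[E1 [E1T ndE1 E1oo]] := sigma_finiteT mu1.
have /sigma_finiteP[E2 [E2T ndE2 E2oo]] := sigma_finiteT mu2.
pose E n := E1 n `*` E2 n.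
have mE n : measurable (E n).
  by apply: measurableX; [case: (E1oo n)|case: (E2oo n)].
have ndE : nondecreasing_seq E.
  move=> m n mn; apply/subsetPset => -[x y] [/= E1x E2y]; split.
    by move: E1x; apply/subsetPset/ndE1.
  by move: E2y; apply/subsetPset/ndE2.
have ET : \bigcup_n E n = setT.
  apply/seteqP; split=> // -[x y] _.
  have [i _ E1x] : (\bigcup_n E1 n) x by rewrite -E1T.
  have [k _ E2y] : (\bigcup_n E2 n) y by rewrite -E2T.
  exists (maxn i k) => //; split.
    by move: E1x; apply/subsetPset/ndE1/leq_maxl.
  by move: E2y; apply/subsetPset/ndE2/leq_maxr.
have WE : W = \bigcup_n (E n `&` W) by rewrite -setI_bigcupl ET setTI.
have sub_oo A B n : measurable A -> measurable B ->
  mu1 (E1 n `&` A) < +oo /\ mu2 (E2 n `&` B) < +oo.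
  have [mE1 oo1] := E1oo n; have [mE2 oo2] := E2oo n => mA mB.
  split; [apply: le_lt_trans oo1|apply: le_lt_trans oo2].
    by rewrite le_measure ?inE//; exact: measurableI.
  by rewrite le_measure ?inE//; exact: measurableI.
have invX A B n : measurable A -> measurable B ->
    asymptotically_invariant (mu1 \x mu2) F T12 (E n `&` A `*` B).
  move=> mA mB; rewrite /E -setXI; have [oo1 oo2] := sub_oo _ _ n mA mB.
  have mEA : measurable (E1 n `&` A) by apply: measurableI => //; case: (E1oo n).
  have mEB : measurable (E2 n `&` B) by apply: measurableI => //; case: (E2oo n).
  by apply: asymptotically_invariant_setX => //; [exact: inv1|exact: inv2].
rewrite WE; apply: asymptotically_invariant_bigcup => //.
- exact: measurable_map_pair.
- by move=> n; exact: measurableI.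
- by move=> m n mn; apply/subsetPset; apply: setSI; exact/subsetPset/ndE.
- by rewrite -WE.
- move=> n.
  have Eoo : (mu1 \x mu2) (E n) < +oo.
    have [mE1 oo1] := E1oo n; have [mE2 oo2] := E2oo n.
    by rewrite product_measure1E// lte_mul_pinfty// ge0_fin_numE.
  apply: (asymptotically_invariant_dynkin measurable_map_pair
    (measurable_prod_measurableType X1 X2)) => //.
  + move=> _ _ [A mA [B mB <-]] [A' mA' [B' mB' <-]]; rewrite -setXI.
    by exists (A `&` A'); [exact: measurableI|exists (B `&` B') => //; exact: measurableI].
  + by rewrite -(setIT (E n)) -setXTT; exact: invX.
  + by move=> _ [A mA [B mB <-]]; exact: invX.
Qed.

End product_asymptotically_invariant.

Section affine_space.
Context {R : realType}.

Definition affine d (a : R) (u v : 'rV[R]_d) : 'rV[R]_d := a *: v + u.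

Lemma affine_invK d (a : R) (u : 'rV[R]_d) : 0 < a ->
  cancel (affine a u) (affine a^-1 (- (a^-1 *: u))).
Proof.
by move=> a0 v; rewrite /affine scalerDr scalerA mulVf ?gt_eqF// scale1r addrK.
Qed.

Lemma measurable_affine d a u : measurable_fun setT (@affine d a u).
Proof.
apply: measurable_fun_coordP => i j.
rewrite (_ : (fun _ => _) = (fun x : R => a * x + u i j) \o (fun v : 'rV[R]_d => v i j : R)).
  apply: measurableT_comp; last exact: measurable_coord.
  by apply: measurable_funD => //; exact: measurable_funM.
by apply/funext => v; rewrite /affine /= !mxE.
Qed.

(** An affine map is a product map once the first coordinate is split off; this drives the induction
    on the dimension. *)
Lemma affine_rV_cons d (a : R) (u : 'rV[R]_d.+1) xv :
  affine a u (rV_cons xv) = rV_cons (a * xv.1 + (rV_uncons u).1, affine a (rV_uncons u).2 xv.2).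
Proof.
rewrite -[LHS]rV_unconsK; congr rV_cons; rewrite -[in RHS](rV_consK xv).
move: (rV_cons xv) => w; rewrite /affine /rV_uncons /=; congr pair.
  by rewrite !mxE.
by apply/rowP => i; rewrite !mxE.
Qed.

Context (J : Type) (F : set_system J) {FF : Filter F} (a : J -> R).
Hypothesis a1 : a @ F --> (1 : R).

Lemma asymptotically_invariant_lebesgue_rV d (u : J -> 'rV[R]_d) (A : set 'rV[R]_d) :
  (forall i, (fun j => u j 0 i) @ F --> (0 : R)) ->
  measurable A -> (lebesgue_rV d A < +oo)%E ->
  asymptotically_invariant (lebesgue_rV d) F (fun j => affine (a j) (u j)) A.
Proof.
elim: d u A => [|d IHd] u A u0 mA Aoo e e0.
  apply: filterE => j S mS.
  (* In dimension 0 every map is the identity. *)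
  rewrite (_ : _ @^-1` _ = S); first by rewrite leeDl// lee_fin ltW.
  by apply/seteqP; split=> v; rewrite /= (thinmx0 (affine _ _ _)) (thinmx0 v).
pose T1 j (x : measurableTypeR R) : measurableTypeR R := a j * x + u j 0 ord0.
pose T2 j := affine (a j) (rV_uncons (u j)).2.
have mT1 j : measurable_fun setT (T1 j).
  by apply: measurable_funD => //; exact: measurable_funM.
have mT2 j : measurable_fun setT (T2 j) by exact: measurable_affine.
have mcons B : measurable B -> measurable (@rV_cons R d @^-1` B).
  by move=> mB; rewrite -[X in measurable X]setTI; exact: measurable_rV_cons.
have inv2 B : measurable B -> (lebesgue_rV d B < +oo)%E ->
    asymptotically_invariant (lebesgue_rV d) F T2 B.
  apply: IHd => i; rewrite (_ : (fun _ => _) = (fun j => u j 0 (lift ord0 i))) //.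
  apply/funext => j; rewrite mxE; congr (u j _ _); exact: val_inj.
have invX : asymptotically_invariant (@lebesgue_measure R \x lebesgue_rV d)%E F
    (fun j xy => (T1 j xy.1, T2 j xy.2)) (rV_cons (d := d) @^-1` A).
  apply: asymptotically_invariant_product => //; last exact: mcons.
  by move=> B mB Boo; exact: asymptotically_invariant_lebesgue_measure.
apply: filterS (invX _ e0) => j h S mS; have := h _ (mcons _ mS).
suff -> : (fun xy => (T1 j xy.1, T2 j xy.2)) @^-1` (rV_cons (d := d) @^-1` S) =
  rV_cons (d := d) @^-1` (affine (a j) (u j) @^-1` S) by [].
by apply/seteqP; split=> xy /=; rewrite affine_rV_cons.
Qed.

(** It rules out atoms in the marginals of a law with a density, so that their distribution
    functions are continuous. *)
Lemma lebesgue_rV_hyperplane d (i : 'I_d) (x : R) :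
  lebesgue_rV d [set v | v 0 i = x] = 0%E.
Proof.
elim: d i => [[]//|d IHd] i.
suff h : (@lebesgue_measure R \x lebesgue_rV d)%E
  (rV_cons (d := d) @^-1` [set v | v 0 i = x]) = 0%E by exact: h.
have lshift0 : ord0 = lshift d (ord0 : 'I_1) by exact: val_inj.
have [k ->|->] := unliftP ord0 i.
  have rshift_k : lift ord0 k = rshift 1 k by exact: val_inj.
  apply: integral0_eq => y _.
  rewrite -[RHS](IHd k) /=; congr (lebesgue_rV d _); apply/seteqP.
  by split=> v; rewrite /xsection /= inE /= /rV_cons rshift_k (@row_mxEr _ 1 1 d).
rewrite (_ : _ @^-1` _ = [set x] `*` setT); last first.
  apply/seteqP; split=> -[y v]; rewrite /= /rV_cons lshift0 (@row_mxEl _ 1 1 d) mxE mulr1n.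
    by [].
  by case.
rewrite product_measure1E//=; have -> := lebesgue_measure_set1 x.
exact: mul0e.
Qed.

End affine_space.

(** * Affine perturbations of a law with a density *)

Section density.
Context d (X : measurableType d) (R : realType) (mu : {measure set X -> \bar R}).
Context (J : Type) (F : set_system J) {FF : Filter F} (T : J -> X -> X).
Hypothesis mT : forall j, measurable_fun setT (T j).
Hypothesis invT : forall A, measurable A -> (mu A < +oo)%E ->
  asymptotically_invariant mu F T A.
Import HBNNSimple.
Local Open Scope ereal_scope.

(** One list of values serves every [S], so bounds uniform in [S] can be added up by induction on
    the list. *)
Lemma integral_nnsfun_sum (h : {nnsfun X >-> R}) :
  exists2 s : seq R, forall r, r \in s -> (0 <= r)%R &
  forall S, measurable S -> \int[mu]_(x in S) (h x)%:E =
    \sum_(r <- s) r%:E * mu (h @^-1` [set r] `&` S).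
Proof.
exists (finmap.enum_fset (fset_set (range h))) => [r|S mS].
  by rewrite in_fset_set; [rewrite inE => -[x _ <-]|exact: fimfunP].
rewrite -fsbig_finite; last exact: fimfunP.
transitivity (\int[mu]_(x in S)
    (\sum_(r \in range h) (r * \1_(h @^-1` [set r]) x)%:E)%R).
  apply: eq_integral => x _; rewrite [in LHS]fimfunE -fsumEFin//; exact: fimfunP.
rewrite ge0_integral_fsum//.
- apply: eq_fsbigr => r _.
  by rewrite integralZl_indic_nnsfun// integral_indic.
- by move=> r; apply/measurable_EFinP; exact: measurable_funM.
- by move=> r x _; rewrite nnfun_muleindic_ge0.
Qed.

Lemma nnsfun_asymptotically_invariant (h : {nnsfun X >-> R}) :
  \int[mu]_x (h x)%:E < +oo -> forall e : R, (0 < e)%R ->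
  \forall j \near F, forall S, measurable S ->
    \int[mu]_(x in T j @^-1` S) (h x)%:E <= \int[mu]_(x in S) (h x)%:E + e%:E.
Proof.
move=> hoo e e0.
have mTj j S : measurable S -> measurable (T j @^-1` S).
  by move=> mS; rewrite -[X in measurable X]setTI; exact: mT.
have [s s0 hE] := integral_nnsfun_sum h.
suff : \forall j \near F, forall S, measurable S ->
    \sum_(r <- s) r%:E * mu (h @^-1` [set r] `&` T j @^-1` S) <=
    \sum_(r <- s) r%:E * mu (h @^-1` [set r] `&` S) + e%:E.
  by apply: filterS => j hj S mS; rewrite !hE//; [exact: hj|exact: mTj].
elim: s e e0 s0 {hE} => [|r s IHs] e e0 s0.
  by apply: filterE => j S mS; rewrite !big_nil add0e lee_fin ltW.
have e20 : (0 < e / 2)%R by rewrite divr_gt0.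
have r0 : (0 <= r)%R by apply: s0; rewrite mem_head.
have {}IHs := IHs _ e20 (fun t ts => s0 t (@mem_behead _ (r :: s) t ts)).
suff invr : \forall j \near F, forall S, measurable S ->
    r%:E * mu (h @^-1` [set r] `&` T j @^-1` S) <=
    r%:E * mu (h @^-1` [set r] `&` S) + (e / 2)%:E.
  apply: filterS2 IHs invr => j h1 h2 S mS; rewrite !big_cons (splitr e) EFinD addeACA.
  by apply: leeD; [exact: h2|exact: h1].
(* The zero level set may have infinite measure, but its term vanishes. *)
move: r0; rewrite le_eqVlt => /predU1P[<-|r0].
  by apply: filterE => j S mS; rewrite !mul0e add0e lee_fin ltW.
have mr : measurable (h @^-1` [set r]) by [].
(* Markov's inequality: [r] times the indicator of the level set lies below the integrable [h]. *)
have roo : mu (h @^-1` [set r]) < +oo.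
  rewrite -(@lte_pmul2l _ r%:E)// gt0_muley ?lte_fin//.
  apply: le_lt_trans hoo.
  rewrite -[X in mu X](setIT (h @^-1` [set r])) -integral_indic//.
  rewrite -ge0_integralZl//; last by rewrite lee_fin ltW.
  - apply: ge0_le_integral => //.
    + by move=> x _; rewrite mule_ge0 ?lee_fin// ltW.
    + by apply: measurable_funeM; apply/measurable_EFinP.
    + by apply/measurable_EFinP.
    + move=> x _; rewrite -EFinM lee_fin indicE.
      by case: (boolP (x \in _)) => [|_]; rewrite ?mulr0// inE /= => ->; rewrite mulr1.
  - by apply/measurable_EFinP.
have er0 : (0 < e / 2 / r)%R by rewrite divr_gt0.
apply: filterS (invT mr roo er0) => j hj S mS.
rewrite (_ : (e / 2)%:E = r%:E * (e / 2 / r)%:E); last first.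
  by rewrite -EFinM [(r * _)%R]mulrC divfK// gt_eqF.
have er0' : 0 <= (e / 2 / r)%:E by rewrite lee_fin ltW.
by rewrite -ge0_muleDr// lee_pmul2l ?lte_fin ?hj//.
Qed.

Lemma density_asymptotically_invariant (nu : {measure set X -> \bar R}) (f : X -> R) :
  measurable_fun setT f -> (forall x, 0 <= f x)%R -> nu setT < +oo ->
  (forall S, measurable S -> nu S = \int[mu]_(x in S) (f x)%:E) ->
  forall e : R, (0 < e)%R -> \forall j \near F, forall S, measurable S ->
    nu (T j @^-1` S) <= nu S + e%:E.
Proof.
move=> mf f0 nuoo nuE e e0; have e20 : (0 < e / 2)%R by rewrite divr_gt0.
have mef : measurable_fun setT (EFin \o f) by exact/measurable_EFinP.
pose h_ := nnsfun_approx measurableT mef.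
have ndh x m k : (m <= k)%N -> (h_ m x <= h_ k x)%R.
  by move=> mk; have /lefP := nd_nnsfun_approx measurableT mef mk.
have cvg_h x : (h_ n x)%:E @[n --> \oo] --> (f x)%:E.
  by apply: cvg_nnsfun_approx => // y _; rewrite lee_fin.
have hf n x : (h_ n x <= f x)%R.
  have /fine_cvgP[_ /= cvg_hx] := cvg_h x.
  rewrite -(cvg_lim _ cvg_hx)//; apply: nondecreasing_cvgn_le.
    by move=> m k mk; exact: ndh.
  by apply/cvg_ex; exists (f x).
have mh n : measurable_fun setT (EFin \o h_ n) by exact/measurable_EFinP.
have cvg_int : \int[mu]_x (h_ n x)%:E @[n --> \oo] --> nu setT.
  rewrite nuE// (eq_integral (fun x => limn (EFin \o h_ ^~ x))); last first.
    by move=> x _; apply/esym/cvg_lim => //; exact: cvg_h.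
  apply: cvg_monotone_convergence => //.
  - by move=> k x _; rewrite lee_fin.
  - by move=> x _ m k mk; rewrite lee_fin; exact: ndh.
have nu_fin S : measurable S -> nu S \is a fin_num.
  move=> mS; rewrite ge0_fin_numE//; apply: le_lt_trans nuoo.
  by rewrite le_measure ?inE.
have int_h n S : measurable S -> \int[mu]_(x in S) (h_ n x)%:E <= nu S.
  move=> mS; rewrite nuE//; apply: ge0_le_integral => //.
  - by move=> x _; rewrite lee_fin.
  - exact: (measurable_funTS (mh n)).
  - exact: (measurable_funTS mef).
  - by move=> x _; rewrite lee_fin.
have int_fin n S : measurable S -> \int[mu]_(x in S) (h_ n x)%:E \is a fin_num.
  move=> mS; rewrite ge0_fin_numE ?integral_ge0// => [|x _]; last by rewrite lee_fin.
  by apply: (le_lt_trans (int_h n _ mS)); rewrite -ge0_fin_numE// nu_fin.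
have [n nuT] : exists n, nu setT <= \int[mu]_x (h_ n x)%:E + (e / 2)%:E.
  move: cvg_int; rewrite -(fineK (nu_fin _ measurableT)) => /fine_cvgP[_].
  move=> /cvgrPdist_le/(_ _ e20)[n _ /(_ _ (leqnn n)) /= h]; exists n.
  rewrite -(fineK (int_fin n _ measurableT)) -EFinD lee_fin.
  by rewrite -lerBlDl; apply: le_trans h; exact: ler_norm.
(* The deficit on [S] is at most the total deficit, since the one on the complement is nonnegative;
   so the bound is uniform in [S]. *)
have nu_le S : measurable S -> nu S <= \int[mu]_(x in S) (h_ n x)%:E + (e / 2)%:E.
  move=> mS; have mSC := measurableC mS.
  have nuTE : nu setT = nu S + nu (~` S).
    rewrite -(setvU S) setUC measureU//; last exact: setICr.
  have intTE : \int[mu]_x (h_ n x)%:E =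
      \int[mu]_(x in S) (h_ n x)%:E + \int[mu]_(x in ~` S) (h_ n x)%:E.
    rewrite -(setvU S) setUC ge0_integral_setU//.
    - exact: (measurable_funTS (mh n)).
    - by move=> x _; rewrite lee_fin.
    - by rewrite disj_set2E setICr.
  move: nuT (int_h n _ mSC); rewrite nuTE intTE.
  rewrite -(fineK (nu_fin _ mS)) -(fineK (nu_fin _ mSC)).
  rewrite -(fineK (int_fin n _ mS)) -(fineK (int_fin n _ mSC)) -!EFinD !lee_fin.
  lra.
have hoo : \int[mu]_x (h_ n x)%:E < +oo.
  by rewrite -ge0_fin_numE ?int_fin ?integral_ge0// => x _; rewrite lee_fin.
apply: filterS (nnsfun_asymptotically_invariant hoo e20) => j hj S mS.
have mTS : measurable (T j @^-1` S) by rewrite -[X in measurable X]setTI; exact: mT.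
apply: (le_trans (nu_le _ mTS)); rewrite [in leRHS](splitr e) EFinD addeA leeD2r//.
apply: (le_trans (hj S mS)); rewrite leeD2r//; exact: int_h.
Qed.

End density.

Lemma continuous_law_affine (R : realType) d (X : probability 'rV[R]_d R) :
  continuous_law X -> forall e : R, 0 < e ->
  exists2 delta : R, 0 < delta & forall (a : R) (u : 'rV[R]_d),
    `|a - 1| < delta -> (forall i, `|u 0 i| < delta) ->
    forall S, measurable S -> (`|X (affine a u @^-1` S) - X S| <= e%:E)%E.
Proof.
move=> [f [mf f0 XE]] e e0.
(* The pairs [(a, u)] index the family of maps themselves, with the neighbourhoods of [(1, 0)] as
   filter; an eventual bound is then a bound with some [delta]. *)
pose F := filter_from [set delta : R | 0 < delta] (fun delta =>
  [set au : R * 'rV[R]_d | `|au.1 - 1| < delta /\ forall i, `|au.2 0 i| < delta]).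
have FF : Filter F.
  apply: filter_from_filter; first by exists 1 => /=.
  move=> x y /= x0 y0; exists (Num.min x y); first by rewrite /= lt_min x0.
  move=> au /= [h1 h2]; split; split; try by move: h1; rewrite lt_min => /andP[].
    by move=> i; move: (h2 i); rewrite lt_min => /andP[].
  by move=> i; move: (h2 i); rewrite lt_min => /andP[].
have F1 : fst @ F --> (1 : R).
  apply/cvgrPdist_lt => x x0; exists x => // au [/= h _].
  by rewrite distrC.
have F2 i : (fun au : R * 'rV[R]_d => au.2 0 i) @ F --> (0 : R).
  apply/cvgrPdist_lt => x x0; exists x => // au [/= _ h].
  by rewrite sub0r normrN.
pose T (au : R * 'rV[R]_d) := affine au.1 au.2.
have mT au : measurable_fun setT (T au) by exact: measurable_affine.
have invT A : measurable A -> (lebesgue_rV d A < +oo)%E ->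
    asymptotically_invariant (lebesgue_rV d) F T A.
  by move=> mA Aoo; exact: asymptotically_invariant_lebesgue_rV.
have Xoo : (X setT < +oo)%E by rewrite probability_setT ltry.
have [delta delta0 h] := density_asymptotically_invariant mT invT mf f0 Xoo XE e0.
exists delta => // a u a1 u0 S mS; have {}h := h (a, u) (conj a1 u0).
have mTS B : measurable B -> measurable (affine a u @^-1` B).
  by move=> mB; rewrite -[X in measurable X]setTI; exact: measurable_affine.
have := h _ mS; have := h _ (measurableC mS).
rewrite /T /= preimage_setC !probability_setC//; last exact: mTS.
rewrite -(fineK (fin_num_measure X _ mS)) -(fineK (fin_num_measure X _ (mTS _ mS))).
rewrite -!EFinB -!EFinD !lee_fin ler_norml.
by move=> h1 h2; apply/andP; split; lra.
Qed.

(** * Distribution functions without atoms *)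

Section atomless_cdf.
Context d (T : measurableType d) (R : realType) (P : probability T R) (c : T -> R).
Hypotheses (mc : measurable_fun setT c) (c0 : forall x, P (c @^-1` [set x]) = 0%E).

Definition atomless_cdf (x : R) : R := fine (P (c @^-1` `]-oo, x]%classic)).

Let mP (I : interval R) : measurable (c @^-1` [set` I]).
Proof. by rewrite -[X in measurable X]setTI; apply: mc => //; exact: measurable_itv. Qed.

Lemma atomless_cdfE x : (atomless_cdf x)%:E = P (c @^-1` `]-oo, x]%classic).
Proof. by rewrite fineK// fin_num_measure. Qed.

Lemma atomless_cdf_ge0 x : 0 <= atomless_cdf x.
Proof. exact: fine_ge0. Qed.

Lemma atomless_cdf_le1 x : atomless_cdf x <= 1.
Proof. by rewrite -lee_fin atomless_cdfE probability_le1. Qed.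

Lemma atomless_cdfB x y : x <= y ->
  P (c @^-1` `]x, y]%classic) = (atomless_cdf y - atomless_cdf x)%:E.
Proof.
move=> xy; rewrite EFinB !atomless_cdfE.
have -> : c @^-1` `]-oo, y]%classic = c @^-1` `]-oo, x]%classic `|` c @^-1` `]x, y]%classic.
  apply/seteqP; split=> t /=; rewrite !in_itv /=; first by case: (leP (c t) x); [left|right].
  by case=> [cx|/andP[]//]; exact: le_trans cx xy.
rewrite measureU//; last first.
  apply/seteqP; split=> // t [] /=; rewrite !in_itv /= => cx /andP[xc _].
  by move: (lt_le_trans xc cx); rewrite ltxx.
by rewrite (addeC (P _)) addeK// fin_num_measure.
Qed.

Lemma atomless_cdf_nondecreasing : {homo atomless_cdf : x y / x <= y}.
Proof. by move=> x y xy; rewrite -subr_ge0 -lee_fin -atomless_cdfB. Qed.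

Lemma atomless_cdf_continuous : continuous atomless_cdf.
Proof.
move=> x; apply/cvgrPdist_lt => e e0.
pose B n := c @^-1` `[x - n.+1%:R^-1, x + n.+1%:R^-1]%classic.
have B0 : P (B n) @[n --> \oo] --> 0%E.
  rewrite -(c0 x) (_ : c @^-1` _ = \bigcap_n B n); last first.
    apply/seteqP; split=> t /=.
      by move=> ctx n _; rewrite /B /= ctx in_itv /= gerBl lerDl invr_ge0 ler0n.
    move=> Bt; apply/eqP; rewrite eq_le; apply/andP; split; rewrite leNgt; apply/negP.
      move=> /ltr_add_invr[n]; have := Bt n I; rewrite /B /= in_itv /= => /andP[_ h].
      by rewrite ltNge h.
    move=> /ltr_add_invr[n]; have := Bt n I; rewrite /B /= in_itv /= => /andP[h _].
    by rewrite ltNge -lerBlDr h.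
  apply: nonincreasing_cvg_mu => //.
  - by rewrite -ge0_fin_numE// fin_num_measure//; exact: mP.
  - by move=> n; exact: mP.
  - by apply: bigcap_measurable => // n _; exact: mP.
  - move=> m n mn; apply/subsetPset => t; rewrite /B /= !in_itv /= => /andP[h1 h2].
    have : n.+1%:R^-1 <= m.+1%:R^-1 :> R by rewrite lef_pV2 ?posrE// ler_nat ltnS.
    move: (n.+1%:R^-1 : R) (m.+1%:R^-1 : R) h1 h2 => p q h1 h2 pq.
    by apply/andP; split; lra.
move: B0 => /fine_cvgP[_] /cvgrPdist_lt/(_ _ e0)[n _ /(_ _ (leqnn n))] /=.
rewrite sub0r normrN ger0_norm ?fine_ge0// => Bn.
have n0 : 0 < n.+1%:R^-1 :> R by rewrite invr_gt0.
rewrite /B in Bn; move: (n.+1%:R^-1 : R) n0 Bn => r r0 Bn.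
(* Every increment inside the window is at most the mass of the window, which shrinks to the atom at
   [x], of mass 0. *)
suff h y z : x - r <= y -> y <= z -> z <= x + r ->
    atomless_cdf z - atomless_cdf y < e.
  exists r => //= y; rewrite /ball /= ltr_norml => /andP[xy1 xy2].
  rewrite ltr_norml; have [xy|yx] := leP x y.
    have F_xy := atomless_cdf_nondecreasing xy.
    have : atomless_cdf y - atomless_cdf x < e by apply: h; lra.
    by move=> h1; apply/andP; split; lra.
  have F_xy := atomless_cdf_nondecreasing (ltW yx).
  have : atomless_cdf x - atomless_cdf y < e by apply: h; lra.
  by move=> h1; apply/andP; split; lra.
move=> xy yz zx; apply: le_lt_trans Bn;
  rewrite -lee_fin -atomless_cdfB// fineK ?fin_num_measure//.
  apply: le_measure; rewrite ?inE; try exact: mP.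
  by move=> t; rewrite /= !in_itv /= => /andP[h1 h2]; apply/andP; split; lra.
Qed.

(** Half of the probability integral transform: a variable composed with its continuous distribution
    function is uniform on [[0, 1]]. *)
Lemma atomless_cdf_itv (u v : R) : u <= v ->
  (P [set t | (u <= atomless_cdf (c t) <= v)%R] <= (v - u)%:E)%E.
Proof.
(* Truncation makes the level set compact, so its extreme points [x <= y] are attained and satisfy
   the level bounds themselves; the mass is then at most the increment from [x] to [y]. *)
move=> uv; pose E n : set R := `[- n%:R, n%:R]%classic `&` atomless_cdf @^-1` `[u, v]%classic.
have compE n : compact (E n).
  apply: (subclosed_compact _ (@segment_compact R (- n%:R) n%:R)); last exact: subIsetl.
  apply: closedI; first exact: interval_closed.
  apply: preimage_closed; last exact: interval_closed.
  by move=> x _; exact: atomless_cdf_continuous.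
have mF : measurable_fun setT (atomless_cdf \o c).
  apply: measurableT_comp => //; apply: continuous_measurable_fun.
  exact: atomless_cdf_continuous.
have mcE n : measurable (c @^-1` E n).
  rewrite preimage_setI; apply: measurableI; first exact: mP.
  rewrite -comp_preimage -[X in measurable X]setTI; apply: mF => //; exact: measurable_itv.
have -> : [set t | u <= atomless_cdf (c t) <= v] = \bigcup_n (c @^-1` E n).
  apply/seteqP; split=> t; last by move=> [n _ [_]]; rewrite /= in_itv.
  move=> /= Ft; exists (Num.truncn `|c t|).+1 => //; split => //=; rewrite ?in_itv//=.
  by have := truncnS_gt `|c t|; rewrite ltr_norml => /andP[/ltW-> /ltW->].
have cvgE : P (c @^-1` E n) @[n --> \oo] --> P (\bigcup_n (c @^-1` E n)).
  apply: nondecreasing_cvg_mu => //; first exact: bigcupT_measurable.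
  move=> m n mn; apply/subsetPset => t [/=]; rewrite in_itv /= => /andP[h1 h2] h.
  have mnR : m%:R <= n%:R :> R by rewrite ler_nat.
  by split => //=; rewrite in_itv /=; apply/andP; split; lra.
rewrite -(cvg_lim _ cvgE)//; apply: lime_le; first by apply/cvg_ex;
  exists (P (\bigcup_n (c @^-1` E n))).
apply: nearW => n; have [En0|/set0P En0] := eqVneq (E n) set0.
  by rewrite En0 preimage_set0 measure0 lee_fin subr_ge0.
have cid : {within E n, continuous (id : R -> R)} by apply: continuous_subspaceT => x.
have [y + ymax] := compact_EVT_max En0 (compE n) cid.
have [x + xmin] := compact_EVT_min En0 (compE n) cid.
rewrite !inE => -[_ /=]; rewrite in_itv /= => /andP[ux _] -[Ey /=].
rewrite in_itv /= => /andP[_ yv].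
have xy : x <= y.
  by case: En0 => z Enz; apply: (le_trans (xmin z _) (ymax z _)); rewrite inE.
apply: (@le_trans _ _ (P (c @^-1` [set x] `|` c @^-1` `]x, y]%classic))).
  rewrite le_measure ?inE//.
    by apply: measurableU; [rewrite -[X in measurable X]setTI; exact: mc|exact: mP].
  move=> t Et; have xt := xmin (c t); have ty := ymax (c t); rewrite /= in_itv /=.
  rewrite !inE in xt, ty; have [xlt|xge] := ltP x (c t); [right|left].
    exact: (ty Et).
  by apply/eqP; rewrite eq_le xge; exact: (xt Et).
apply: (le_trans (measureU2 _ _ _)).
- by rewrite -[X in measurable X]setTI; exact: mc.
- exact: mP.
- rewrite [X in (X + _)%E](_ : _ = 0%E) ?add0e; last exact: c0.
  by have := atomless_cdfB xy => /= ->; rewrite lee_fin lerB.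
Qed.

End atomless_cdf.

(** * Uniform convergence over rectangles *)

Section clamp.
Context {R : realType}.
Implicit Types s t : R.

Definition clamp t : R := Num.min 1 (Num.max 0 t).

(** A continuous function equal to 1 on [[0, 1]] and to 0 off [[- 1/2, 3/2]]. *)
Definition bump t : R := clamp (2 - `|2 * t - 1|).

Lemma clamp_ge0 t : 0 <= clamp t.
Proof. by rewrite /clamp le_min ler01 le_max lexx. Qed.

Lemma clamp_le1 t : clamp t <= 1.
Proof. by rewrite /clamp ge_min lexx. Qed.

Lemma clamp_eq0 t : t <= 0 -> clamp t = 0.
Proof. by move=> t0; rewrite /clamp (max_idPl t0) (min_idPr ler01). Qed.

Lemma clamp_eq1 t : 1 <= t -> clamp t = 1.
Proof. by move=> t1; rewrite /clamp (max_idPr _) ?(min_idPl t1)//; exact: le_trans t1. Qed.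

Lemma bump_ge0 t : 0 <= bump t. Proof. exact: clamp_ge0. Qed.

Lemma bump_le1 t : bump t <= 1. Proof. exact: clamp_le1. Qed.

(** With [clamp_le1_bump] this compares [clamp] to a step whose jump is only known to lie in
    [[0, 1]]: the value 1 occurs only for [t >= 0], the value 0 only for [t <= 1]. *)
Lemma clamp_ge0_bump t : 0 <= t -> `|1 - clamp t| <= bump t.
Proof.
move=> t0; have [t1|t1] := leP 1 t; first by rewrite clamp_eq1// subrr normr0 bump_ge0.
rewrite /bump [leRHS]clamp_eq1; last first.
  have : `|2 * t - 1| <= 1 by rewrite ler_norml; apply/andP; split; lra.
  lra.
by rewrite ger0_norm ?subr_ge0 ?clamp_le1// gerBl clamp_ge0.
Qed.

Lemma clamp_le1_bump t : t <= 1 -> `|clamp t| <= bump t.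
Proof.
move=> t1; have [t0|t0] := leP t 0; first by rewrite clamp_eq0// normr0 bump_ge0.
rewrite /bump [leRHS]clamp_eq1; last first.
  have : `|2 * t - 1| <= 1 by rewrite ler_norml; apply/andP; split; lra.
  lra.
by rewrite ger0_norm ?clamp_ge0 ?clamp_le1.
Qed.

Lemma bump_eq0 t : ~~ (- 2^-1 <= t <= 3 / 2) -> bump t = 0.
Proof.
rewrite negb_and -!ltNge => ht; apply: clamp_eq0; rewrite subr_le0.
by rewrite ler_normr; case/orP: ht => ht; apply/orP; [right|left]; lra.
Qed.

Lemma clamp_continuous : continuous clamp.
Proof.
move=> t; apply: (@continuous_min R R (cst 1) (fun x => Num.max 0 x));
  first exact: cst_continuous.
by apply: (@continuous_max R R (cst 0) id); first exact: cst_continuous.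
Qed.

Lemma bump_continuous : continuous bump.
Proof.
move=> t; apply: (@continuous_comp _ _ _ (fun t => 2 - `|2 * t - 1|) clamp);
  last exact: clamp_continuous.
apply: cvgB; first exact: cvg_cst.
apply: (@cvg_norm _ R^o); apply: cvgB; last exact: cvg_cst.
by apply: cvgM; [exact: cvg_cst|exact: cvg_id].
Qed.

(** Whatever the half-line, open or closed, one of only [K] levels locates it. The infimum [t] of
    [F] on [A] separates the values on and off [A], and [j] is the cell [[j / K, (j + 1) / K]]
    containing [t]. *)
Lemma upset_clamp (F : R -> R) (K : nat) (A : set R) : (0 < K)%N ->
  (forall x, 0 <= F x <= 1) -> {homo F : x y / x <= y} ->
  (forall x y, A x -> x <= y -> A y) ->
  exists2 j : 'I_K, forall x, A x -> 0 <= K%:R * F x - j%:R &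
                    forall x, ~ A x -> K%:R * F x - j%:R <= 1.
Proof.
move=> K0 F01 Fnd upA.
suff [t t01 [At nAt]] : exists2 t, 0 <= t <= 1 &
    (forall x, A x -> t <= F x) /\ (forall x, ~ A x -> F x <= t).
  have KR : 0 < K%:R :> R by rewrite ltr0n.
  have Kt0 : 0 <= K%:R * t by case/andP: t01 => t0 _; rewrite mulr_ge0.
  have [tK|tK] := ltnP (Num.truncn (K%:R * t)) K.
    exists (Ordinal tK) => x Ax /=.
      by rewrite subr_ge0 (@le_trans _ _ (K%:R * t)) ?truncn_le ?ler_pM2l ?At.
    rewrite lerBlDr (@le_trans _ _ (K%:R * t)) ?ler_pM2l ?nAt//.
    by have /ltW := truncnS_gt (K%:R * t); rewrite -natr1 addrC.
  (* The value [t = 1] is assigned to the last cell. *)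
  have tE : t = 1.
    apply/eqP; rewrite eq_le; case/andP: t01 => _ ->/=.
    by rewrite -(ler_pM2l KR) mulr1 -truncn_ge_nat.
  have K1 : (K.-1 < K)%N by rewrite prednK.
  have Kp : K.-1%:R + 1 = K%:R :> R by rewrite natr1 prednK.
  exists (Ordinal K1) => x Ax /=.
    have /(ler_wpM2l (ltW KR)) := At _ Ax; rewrite tE; lra.
  case/andP: (F01 x) => _ /(ler_wpM2l (ltW KR)); lra.
have [[a Aa]|A0] := pselect (exists a, A a); last first.
  (* For empty [A] there is no infimum to take, and the top level separates. *)
  exists 1; [by rewrite lexx ler01|split=> x]; first by move=> Ax; case: A0; exists x.
  by move=> _; case/andP: (F01 x).
have lbF : has_lbound (F @` A) by exists 0 => _ [x _ <-]; case/andP: (F01 x).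
have F0 : F @` A !=set0 by exists (F a), a.
have inf0 : 0 <= inf (F @` A) by apply: lb_le_inf => // _ [x _ <-]; case/andP: (F01 x).
have infF x : A x -> inf (F @` A) <= F x by move=> Ax; apply: ge_inf => //; exists x.
exists (inf (F @` A)).
  by rewrite inf0; apply: (le_trans (infF _ Aa)); case/andP: (F01 a).
split=> // x nAx; apply: lb_le_inf => // _ [y Ay <-]; apply: Fnd.
by rewrite leNgt; apply/negP => /ltW yx; apply: nAx; exact: upA yx.
Qed.

(** Factors are exchanged one at a time, the others being bounded by 1. *)
Lemma ler_dist_prod (I : Type) (s : seq I) (a b : I -> R) :
  (forall i, 0 <= a i <= 1) -> (forall i, 0 <= b i <= 1) ->
  `|\prod_(i <- s) a i - \prod_(i <- s) b i| <= \sum_(i <- s) `|a i - b i|.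
Proof.
move=> a01 b01; elim: s => [|i s IHs]; first by rewrite !big_nil subrr normr0.
rewrite !big_cons.
have -> : a i * \prod_(j <- s) a j - b i * \prod_(j <- s) b j =
    (a i - b i) * \prod_(j <- s) a j + b i * (\prod_(j <- s) a j - \prod_(j <- s) b j) by ring.
apply: (le_trans (ler_normD _ _)); rewrite !normrM; apply: lerD.
  apply: ler_piMr => //; rewrite ger0_norm; last by apply: prodr_ge0 => j _;
    case/andP: (a01 j).
  by apply: prodr_ile1 => j _.
apply: le_trans IHs; apply: ler_piMl => //.
by case/andP: (b01 i) => b0 b1; rewrite ger0_norm.
Qed.

End clamp.

Lemma measurable_rectangle (R : realType) d (S : set 'rV[R]_d) :
  rectangle S -> measurable S.
Proof.
move=> [I ->]; rewrite (_ : [set _ | _] =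
    \bigcap_(i in [set: 'I_d]) ((fun v : 'rV[R]_d => v 0 i) @^-1` [set` I i])); last first.
  by apply/seteqP; split=> v /= vI i; move: (vI i) => //; exact.
apply: fin_bigcap_measurable => // i _.
by rewrite -[X in measurable X]setTI; apply: (@measurable_coord _ R 1 d 0 i).
Qed.

Lemma continuous_law_coord (R : realType) d (X : probability 'rV[R]_d R) i x :
  continuous_law X -> X ((fun v : 'rV[R]_d => v 0 i) @^-1` [set x]) = 0%E.
Proof.
move=> [f [mf f0 XE]].
have mH : measurable ((fun v : 'rV[R]_d => v 0 i) @^-1` [set x]).
  rewrite -[X in measurable X]setTI; apply: (@measurable_coord _ R 1 d 0 i) => //.
rewrite XE//; apply: null_set_integral => //.
  by apply: measurable_funTS; exact/measurable_EFinP.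
exact: lebesgue_rV_hyperplane.
Qed.

Lemma continuous_prod (R : realType) (T : topologicalType) (I : Type) (s : seq I)
    (f : I -> T -> R) : (forall i, continuous (f i)) ->
  continuous (fun x => \prod_(i <- s) f i x).
Proof.
move=> cf; elim: s => [|i s IHs].
  by under eq_fun do rewrite big_nil; exact: cst_continuous.
under eq_fun do rewrite big_cons.
by move=> x; apply: (@cvgM R _ _ _ (f i)); [exact: cf|exact: IHs].
Qed.

Lemma continuous_sum (R : realType) (T : topologicalType) (I : Type) (s : seq I)
    (f : I -> T -> R) : (forall i, continuous (f i)) ->
  continuous (fun x => \sum_(i <- s) f i x).
Proof.
move=> cf; elim: s => [|i s IHs].
  by under eq_fun do rewrite big_nil; exact: cst_continuous.
under eq_fun do rewrite big_cons.
by move=> x; apply: (@cvgD R R^o _ _ _ (f i)); [exact: cf|exact: IHs].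
Qed.

Lemma cvge_near (R : realType) (u : nat -> \bar R) (l : R) : u @ \oo --> l%:E ->
  forall e : R, 0 < e -> \forall n \near \oo,
    (u n <= l%:E + e%:E)%E /\ (l%:E <= u n + e%:E)%E.
Proof.
move=> /fine_cvgP[ufin ul] e e0; move/cvgrPdist_le : ul => /(_ _ e0) ul.
apply: filterS2 ufin ul => n un /=.
rewrite -(fineK un) /= -!EFinD !lee_fin ler_norml => /andP[h1 h2].
by split; lra.
Qed.

Lemma cvg_in_distribution_rectangle (R : realType) d (P : nat -> probability 'rV[R]_d R)
    (X : probability 'rV[R]_d R) :
  continuous_law X -> cvg_in_distribution (fun n => P n) X ->
  forall e : R, 0 < e -> \forall n \near \oo, forall S, rectangle S ->
    (`|P n S - X S| <= e%:E)%E.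
Proof.
move=> cX PX e e0.
pose co i (v : 'rV[R]_d) : R := v 0 i.
have mco i : measurable_fun setT (co i) by exact: (@measurable_coord _ R 1 d 0 i).
have co0 i x : X (co i @^-1` [set x]) = 0%E by exact: continuous_law_coord.
pose F i := atomless_cdf X (co i).
have cF i : continuous (F i) by apply: atomless_cdf_continuous.
have F01 i x : 0 <= F i x <= 1 by rewrite atomless_cdf_ge0 atomless_cdf_le1.
have Fnd i : {homo F i : x y / x <= y} by apply: atomless_cdf_nondecreasing.
(* One condition per end of each side; [true] marks the lower end. *)
pose D := ('I_d * bool)%type.
(* Each bump has mean at most [2 / K] under [X], because its support spans two levels; this [K]
   makes the bumps of all conditions add up to at most [e / 4]. *)
pose K := (Num.truncn (8 * #|{: D}|%:R / e)).+1.
have KR : 0 < K%:R :> R by rewrite ltr0n.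
have K_large : #|{: D}|%:R * (2 / K%:R) <= e / 4.
  have : 8 * #|{: D}|%:R / e < K%:R by exact: truncnS_gt.
  rewrite ltr_pdivrMr// => h; rewrite mulrA ler_pdivrMr//; lra.
pose level (J : {ffun D -> 'I_K}) (q : D) (v : 'rV[R]_d) : R :=
  K%:R * F q.1 (co q.1 v) - (J q)%:R.
(* The condition at an upper end holds on a down-set, so its complement is the up-set to
   approximate. *)
pose half J q v := if q.2 then clamp (level J q v) else 1 - clamp (level J q v).
pose phi J v := \prod_q half J q v.
pose W J v := \sum_q bump (level J q v).
have half01 J q v : 0 <= half J q v <= 1.
  rewrite /half; have := clamp_ge0 (level J q v); have := clamp_le1 (level J q v).
  by case: ifP => _ h1 h2; apply/andP; split; lra.
have phi0 J v : 0 <= phi J v.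
  by apply: prodr_ge0 => q _; have /andP[] := half01 J q v.
have phi1 J v : phi J v <= 1 by apply: prodr_ile1 => q _.
have W0 J v : 0 <= W J v by apply: sumr_ge0 => q _; exact: bump_ge0.
have WD J v : W J v <= #|{: D}|%:R.
  by rewrite -sum1_card natr_sum; apply: ler_sum => q _; exact: bump_le1.
have clevel J q : continuous (level J q).
  have clin : continuous (fun t : R => K%:R * t - (J q)%:R).
    move=> t; apply: cvgB; last exact: cvg_cst.
    by apply: cvgM; [exact: cvg_cst|exact: cvg_id].
  move=> v; apply: (@continuous_comp _ _ _ (F q.1 \o co q.1) (fun t =>
    K%:R * t - (J q)%:R)) => //.
    by apply: (@continuous_comp _ _ _ (co q.1) (F q.1)); [exact: coord_continuous|exact: cF].
  exact: clin.
have mlevel J q : measurable_fun setT (level J q).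
  apply: measurable_funB => //; apply: measurable_funM => //.
  by apply: measurableT_comp => //; exact: continuous_measurable_fun.
have cclamp J q : continuous (fun v => clamp (level J q v)).
  move=> v; apply: (@continuous_comp _ _ _ (level J q) clamp); first exact: clevel.
  exact: clamp_continuous.
have mclamp J q : measurable_fun setT (fun v => clamp (level J q v)).
  by apply: measurableT_comp => //; apply: continuous_measurable_fun; exact: clamp_continuous.
have mbump J q : measurable_fun setT (fun v => bump (level J q v)).
  by apply: measurableT_comp => //; apply: continuous_measurable_fun; exact: bump_continuous.
have chalf J q : continuous (half J q).
  rewrite /half; case: q.2; first exact: cclamp.
  have csub : continuous (fun t : R => 1 - t).
    by move=> t; apply: cvgB; [exact: cvg_cst|exact: cvg_id].
  move=> v; apply: (@continuous_comp _ _ _ (fun v => clamp (level J q v)) (fun t => 1 - t)).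
    exact: cclamp.
  exact: csub.
have mhalf J q : measurable_fun setT (half J q).
  by rewrite /half; case: q.2 => //; exact: measurable_funB.
have cphi J : continuous (phi J) by exact: continuous_prod.
have mphi J : measurable_fun setT (phi J) by exact: measurable_prod.
have cW J : continuous (W J).
  apply: continuous_sum => q v; apply: (@continuous_comp _ _ _ (level J q) bump).
    exact: clevel.
  exact: bump_continuous.
have mW J : measurable_fun setT (W J) by exact: measurable_sum.
have bracket S : rectangle S -> exists J, forall v, `|\1_S v - phi J v| <= W J v.
  move=> [I ->].
  have upper_half q : exists j : 'I_K, forall v,
      `|(if q.2 then ((I q.1).1 <= BLeft (co q.1 v))%O else (BRight (co q.1 v) <= (I q.1).2)%O)%:R -
        (if q.2 then clamp (K%:R * F q.1 (co q.1 v) - j%:R)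
         else 1 - clamp (K%:R * F q.1 (co q.1 v) - j%:R))| <=
      bump (K%:R * F q.1 (co q.1 v) - j%:R).
    case: q => i [] /=.
      have [|j jA jnA] := @upset_clamp R (F i) K [set x | ((I i).1 <= BLeft x)%O]
        isT (F01 i) (Fnd i).
        by move=> x y /= Ix xy; apply: (le_trans Ix); rewrite bnd_simp.
      exists j => v; case: (boolP ((I i).1 <= BLeft (co i v))%O) => h.
        exact/clamp_ge0_bump/jA.
      by rewrite sub0r normrN; apply/clamp_le1_bump/jnA => /=; exact/negP.
    have [|j jA jnA] := @upset_clamp R (F i) K [set x | ~~ (BRight x <= (I i).2)%O]
      isT (F01 i) (Fnd i).
      move=> x y /= + xy; apply: contra => Iy; apply: le_trans Iy.
      by rewrite bnd_simp.
    exists j => v; case: (boolP (BRight (co i v) <= (I i).2)%O) => h.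
      by rewrite opprB addrC subrK; apply/clamp_le1_bump/jnA => /=; rewrite h.
    by rewrite sub0r normrN; exact/clamp_ge0_bump/jA.
  have [j jP] := choice upper_half.
  exists [ffun q => j q] => v.
  rewrite (_ : \1__ v = \prod_(q : D)
    (if q.2 then ((I q.1).1 <= BLeft (co q.1 v))%O else (BRight (co q.1 v) <= (I q.1).2)%O)%:R).
    apply: (le_trans (ler_dist_prod _ _ _)) => [q|q|]; last 1 first.
    - by apply: ler_sum => q _; rewrite /half /level !ffunE; exact: jP.
    - by case: (if q.2 then _ else _); rewrite ?lexx ?ler01.
    - exact: half01.
  have itvE (L : interval R) (x : R) :
      (x \in L) = (L.1 <= BLeft x)%O && (BRight x <= L.2)%O.
    by case: L => l r; rewrite itv_boundlr.
  rewrite indicE; have [vI|vI] := pselect (forall i, v 0 i \in I i).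
    rewrite mem_set// big1// => -[i b] _ /=; have := vI i; rewrite itvE => /andP[h1 h2].
    by case: b; rewrite ?h1 ?h2.
  rewrite memNset//; move/existsNP : vI => [i /negP].
  rewrite itvE negb_and => /orP[] /negPf h.
    by rewrite (bigD1 (i, true))//= /co h mul0r.
  by rewrite (bigD1 (i, false))//= /co h mul0r.
have int_fin (Q : probability 'rV[R]_d R) (f : 'rV[R]_d -> R) (C : R) :
    measurable_fun setT f -> (forall v, 0 <= f v) -> (forall v, f v <= C) ->
    (\int[Q]_v (f v)%:E)%E \is a fin_num.
  move=> mf f0 fC; rewrite ge0_fin_numE; last by apply: integral_ge0 => v _; rewrite lee_fin.
  apply: (@le_lt_trans _ _ (\int[Q]_v C%:E)%E).
    apply: ge0_le_integral => //; try by move=> v _; rewrite lee_fin.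
    exact/measurable_EFinP.
  rewrite integral_cst// [X in (_ * X)%E](_ : _ = 1%E) ?mule1 ?ltry//.
  exact: probability_setT.
(* Only the limit law is known to put little mass on the cells; for [P n] the bound on [W] is
   inherited through convergence, at the cost of another [e / 4]. *)
have intW J : (\int[X]_v (W J v)%:E <= (e / 4)%:E)%E.
  under eq_integral do rewrite -sumEFin.
  rewrite ge0_integral_sum//; last 2 first.
  - by move=> q; exact/measurable_EFinP.
  - by move=> q v _; rewrite lee_fin bump_ge0.
  apply: (@le_trans _ _ (\sum_(q : D) (2 / K%:R)%:E)%E); last first.
    by rewrite sumEFin lee_fin sumr_const; apply: le_trans K_large; rewrite -[leLHS]mulr_natl.
  apply: lee_sum => q _.
  pose u : R := ((J q)%:R - 2^-1) / K%:R; pose w : R := ((J q)%:R + 3 / 2) / K%:R.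
  have uw : u <= w by rewrite ler_pM2r ?invr_gt0//; lra.
  have -> : 2 / K%:R = w - u by rewrite /u /w -mulrBl; congr (_ / _); field.
  apply: le_trans (atomless_cdf_itv (mco q.1) (co0 q.1) uw).
  have mB : measurable [set v | u <= F q.1 (co q.1 v) <= w].
    rewrite (_ : [set _ | _] = (F q.1 \o co q.1) @^-1` `[u, w]%classic).
      rewrite -[X in measurable X]setTI; apply: measurableT_comp => //.
      exact: continuous_measurable_fun.
    by apply/seteqP; split=> v; rewrite /= in_itv.
  rewrite -(setIT [set v | _]) -integral_indic//; apply: ge0_le_integral => //.
  - by move=> v _; rewrite lee_fin bump_ge0.
  - exact/measurable_EFinP.
  - exact/measurable_EFinP.
  - move=> v _; rewrite lee_fin indicE.
    case: (boolP (v \in _)) => [_|]; first exact: bump_le1.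
    rewrite notin_setE /= => /negP vB; rewrite bump_eq0//; apply: contra vB.
    rewrite /level /u /w => /andP[h1 h2].
    rewrite ler_pdivrMr// ler_pdivlMr// [F _ _ * _]mulrC.
    by apply/andP; split; lra.
have compare (Q : probability 'rV[R]_d R) S J : measurable S ->
    (forall v, `|\1_S v - phi J v| <= W J v) ->
    (Q S <= \int[Q]_v (phi J v)%:E + \int[Q]_v (W J v)%:E)%E /\
    (\int[Q]_v (phi J v)%:E <= Q S + \int[Q]_v (W J v)%:E)%E.
  move=> mS SJ.
  have le_integral3 (f1 f2 f3 : 'rV[R]_d -> R) : measurable_fun setT f1 ->
      measurable_fun setT f2 -> measurable_fun setT f3 ->
      (forall v, 0 <= f1 v) -> (forall v, 0 <= f2 v) -> (forall v, 0 <= f3 v) ->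
      (forall v, f1 v <= f2 v + f3 v) ->
      (\int[Q]_v (f1 v)%:E <= \int[Q]_v (f2 v)%:E + \int[Q]_v (f3 v)%:E)%E.
    move=> /measurable_EFinP m1 /measurable_EFinP m2 /measurable_EFinP m3 f10 f20 f30 f123.
    rewrite -ge0_integralD//; try by move=> v _; rewrite lee_fin.
    apply: ge0_le_integral => //; first by move=> v _; rewrite lee_fin.
      exact: emeasurable_funD.
    by move=> v _; rewrite -EFinD lee_fin.
  have Q_S : Q S = (\int[Q]_v (\1_S v)%:E)%E by rewrite integral_indic// setIT.
  rewrite Q_S; split; apply: le_integral3 => // v;
    by have := SJ v; rewrite ler_norml => /andP[h1 h2]; lra.
have e40 : 0 < e / 4 by rewrite divr_gt0.
have near_phi J : \forall n \near \oo,
    (\int[P n]_v (phi J v)%:E <= \int[X]_v (phi J v)%:E + (e / 4)%:E)%E /\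
    (\int[X]_v (phi J v)%:E <= \int[P n]_v (phi J v)%:E + (e / 4)%:E)%E.
  have fin := int_fin X _ _ (mphi J) (phi0 J) (phi1 J).
  rewrite -(fineK fin); apply: cvge_near => //; rewrite fineK//; apply: PX => //.
  by exists 1 => v; rewrite ger0_norm.
have near_W J : \forall n \near \oo,
    (\int[P n]_v (W J v)%:E <= \int[X]_v (W J v)%:E + (e / 4)%:E)%E /\
    (\int[X]_v (W J v)%:E <= \int[P n]_v (W J v)%:E + (e / 4)%:E)%E.
  have fin := int_fin X _ _ (mW J) (W0 J) (WD J).
  rewrite -(fineK fin); apply: cvge_near => //; rewrite fineK//; apply: PX => //.
  by exists #|{: D}|%:R => v; rewrite ger0_norm.
(* There are finitely many [J], so one rank of convergence serves them all, hence all rectangles. *)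
have all_phi := @filter_forall _ _ _ _ eventually_filter near_phi.
have all_W := @filter_forall _ _ _ _ eventually_filter near_W.
apply: filterS2 all_phi all_W => n hphi hW S rS.
have mS := measurable_rectangle rS; have [J SJ] := bracket S rS.
have [a1 a2] := compare (P n) S J mS SJ; have [b1 b2] := compare X S J mS SJ.
have [c1 c2] := hphi J; have [d1 d2] := hW J; have w0 := intW J.
have f1 := int_fin X _ _ (mphi J) (phi0 J) (phi1 J).
have f2 := int_fin X _ _ (mW J) (W0 J) (WD J).
have f3 := int_fin (P n) _ _ (mphi J) (phi0 J) (phi1 J).
have f4 := int_fin (P n) _ _ (mW J) (W0 J) (WD J).
have f5 := fin_num_measure X _ mS; have f6 := fin_num_measure (P n) _ mS.
move: a1 a2 b1 b2 c1 c2 d1 d2 w0.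
rewrite -(fineK f1) -(fineK f2) -(fineK f3) -(fineK f4) -(fineK f5) -(fineK f6).
rewrite -!EFinD !lee_fin ler_norml => *.
by apply/andP; split; lra.
Qed.

(** * Powers of ratios of sample sizes *)

Section powR_asymptotics.
Context {R : realType}.
Implicit Types a b r x : R.

Lemma ln_dist1 r : 2^-1 <= r -> `|ln r| <= 2 * `|r - 1|.
Proof.
move=> r2; have r0 : 0 < r by lra.
have h1 : ln r <= r - 1.
  by have := expR_ge1Dx (ln r); rewrite lnK ?posrE// lerBrDl.
have h2 : - ln r <= 2 * `|r - 1|.
  have := expR_ge1Dx (- ln r); rewrite expRN lnK ?posrE// => h.
  have [r1|r1] := leP 1 r; first by have := ln_ge0 r1; have := normr_ge0 (r - 1); lra.
  have -> : `|r - 1| = 1 - r by rewrite ltr0_norm ?subr_lt0// opprB.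
  suff : r^-1 <= 1 + 2 * (1 - r) by lra.
  rewrite -(ler_pM2l r0) mulfV ?gt_eqF//; nra.
rewrite ler_norml; apply/andP; split; first by lra.
by apply: (le_trans h1); have := ler_norm (r - 1); have := normr_ge0 (r - 1); lra.
Qed.

Lemma expR_dist1 x : `|x| <= 2^-1 -> `|expR x - 1| <= 2 * `|x|.
Proof.
rewrite ler_norml => /andP[x1 x2]; have h1 := expR_ge1Dx x.
have h2 : expR x * (1 - x) <= 1.
  have := expR_ge1Dx (- x); rewrite expRN => h.
  by rewrite -ler_pdivlMl ?expR_gt0// mulr1.
have e0 := expR_gt0 x.
have [x0|x0] := leP 0 x.
  by rewrite (ger0_norm x0) ger0_norm; [nra|lra].
by rewrite (ltr0_norm x0) ler_norml; apply/andP; split; [lra|nra].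
Qed.

(** Linear bounds for [ln] near 1 and [expR] near 0 compose, each with factor 2; the hypothesis
    gives [r >= 1/2] and [|a ln r| <= 1/2]. *)
Lemma powR_dist1 a r : `|r - 1| <= (4 * (`|a| + 1))^-1 ->
  `|r `^ a - 1| <= 4 * `|a| * `|r - 1|.
Proof.
have a0 := normr_ge0 a; have a1 : 0 < 4 * (`|a| + 1) by lra.
rewrite -[X in _ <= X]mul1r ler_pdivlMr// => ra.
have d0 := normr_ge0 (r - 1).
have r2 : 2^-1 <= r by have := ler_norm (- (r - 1)); rewrite normrN; nra.
rewrite /powR gt_eqF; last by lra.
have lnr := ln_dist1 r2; have ln0 := normr_ge0 (ln r).
apply: (le_trans (expR_dist1 _)); rewrite normrM; nra.
Qed.

(* [r = m / n] is the ratio of two sample sizes and [q = n^b]. *)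
Lemma powR_ratio_small a b g delta : 0 < b -> 0 <= g -> 0 < delta ->
  exists2 eta : R, 0 < eta <= 2^-1 & forall r q, 0 <= q ->
    `|r - 1| <= eta -> `|a| * (q * `|r - 1|) <= `|a| * eta ->
    [/\ `|r `^ (b - a) - 1| < delta,
        `|r^-1 `^ (b - a) - 1| < delta,
        `|q * r `^ b * (r `^ (- a) - 1)| * g < delta &
        `|q * (r^-1 `^ (- a) - 1)| * g < delta].
Proof.
move=> b0 g0 delta0; pose B := `|a| + `|b| + `|b - a| + 1.
have [a_ge0 b_ge0 ba_ge0] : [/\ 0 <= `|a|, 0 <= `|b| & 0 <= `|b - a|] by split.
have B1 : 1 <= B by rewrite /B; lra.
(* The first bound allows [powR_dist1] for every exponent of size at most [B - 1]; the second brings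
   the resulting errors below [delta]. *)
pose eta := Num.min (8 * B)^-1 (delta / (16 * B * (g + 1))).
have eta0 : 0 < eta.
  by rewrite lt_min invr_gt0 divr_gt0 ?mulr_gt0//; lra.
have etaB : eta <= (8 * B)^-1 by rewrite ge_min lexx.
have eta_delta : 16 * B * (g + 1) * eta <= delta.
  rewrite mulrC -ler_pdivlMr ?mulr_gt0//; try lra.
  by rewrite ge_min lexx orbT.
have eta8 : eta * (8 * B) <= 1 by rewrite -ler_pdivlMr ?mul1r//; lra.
have le_exp x : `|x| <= B - 1 -> eta <= (4 * (`|x| + 1))^-1.
  move=> xB; apply: (le_trans etaB); rewrite lef_pV2 ?posrE.
  - by have := normr_ge0 x; lra.
  - by lra.
  - by have := normr_ge0 x; lra.
exists eta; first by rewrite eta0 /=; nra.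
move=> r q q0 r_eta qr_eta.
have r_pos : 0 < r by have := ler_norm (- (r - 1)); rewrite normrN; nra.
have d0 := normr_ge0 (r - 1).
have dist x : `|x| <= B - 1 -> `|r `^ x - 1| <= 4 * `|x| * `|r - 1|.
  by move=> xB; apply: powR_dist1; apply: (le_trans r_eta); exact: le_exp.
have powV x : r^-1 `^ x = r `^ (- x).
  by rewrite -powR_inv1 ?(ltW r_pos)// -powRrM mulN1r.
have gB : B * eta <= 16^-1 * delta.
  have : B * eta <= B * (g + 1) * eta by rewrite ler_pM2r// ler_peMr; lra.
  by have := eta_delta; lra.
have ba_small x : `|x| = `|b - a| -> `|r `^ x - 1| < delta.
  move=> xE; have := dist x; rewrite xE => /(_ _) h.
  have {}h : `|r `^ x - 1| <= 4 * `|b - a| * `|r - 1| by apply: h; rewrite /B; lra.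
  apply: (le_lt_trans h).
  have : `|b - a| * `|r - 1| <= B * eta by apply: ler_pM => //; rewrite /B; lra.
  by lra.
have a_small x : `|x| = `|a| -> `|q * (r `^ x - 1)| * g <= delta / 4.
  move=> xE; have := dist x; rewrite xE => h.
  have {}h : `|r `^ x - 1| <= 4 * `|a| * `|r - 1| by apply: h; rewrite /B; lra.
  rewrite normrM (ger0_norm q0).
  have h2 : q * `|r `^ x - 1| <= 4 * (`|a| * eta).
    apply: (le_trans (ler_wpM2l q0 h)); apply: le_trans (ler_wpM2l _ qr_eta); lra.
  apply: (le_trans (ler_wpM2r g0 h2)).
  have : `|a| * eta * g <= B * (g + 1) * eta.
    rewrite mulrAC ler_pM2r//; apply: ler_pM => //; rewrite /B; lra.
  by have := eta_delta; lra.
split.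
- exact: ba_small.
- by rewrite powV; apply: ba_small; rewrite normrN.
- have rb2 : `|r `^ b| <= 2.
    have : `|r `^ b - 1| <= 4 * `|b| * `|r - 1| by apply: dist; rewrite /B; lra.
    have : `|b| * `|r - 1| <= B * eta by apply: ler_pM => //; rewrite /B; lra.
    move=> h1 h2; have h3 : `|r `^ b - 1| <= 1 by lra.
    by rewrite -[r `^ b](subrK 1); apply: (le_trans (ler_normD _ _)); rewrite normr1; lra.
  have {}a_small : `|q * (r `^ (- a) - 1)| * g <= delta / 4 by apply: a_small; rewrite normrN.
  rewrite mulrAC normrM mulrAC -mulrA mulrC.
  have g1 : 0 <= `|q * (r `^ (- a) - 1)| * g by rewrite mulr_ge0.
  have : `|r `^ b| * (`|q * (r `^ (- a) - 1)| * g) <= 2 * (delta / 4).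
    by apply: ler_pM.
  by rewrite mulrC [g * _]mulrC; lra.
- rewrite powV opprK; apply: (le_lt_trans (a_small a erefl)); lra.
Qed.

(** The factor [|a|] on both sides lets one statement cover both rates: for [a = 0] the second bound
    is void. *)
Lemma A2_rate_ratio a b (c : nat -> R) (C eta : R) : 0 < b -> A2_rate a b c ->
  0 < eta -> \forall n \near \oo, (1 <= n)%N /\
    forall m, `|m - n%:R| <= C * `|c n| ->
      `|m / n%:R - 1| <= eta /\
      `|a| * (n%:R `^ b * `|m / n%:R - 1|) <= `|a| * eta.
Proof.
move=> b0 rate eta0; pose C' := `|C| + 1.
have C'0 : 0 < C' by rewrite ltr_wpDl.
have CC' : C <= C' by rewrite /C'; have := ler_norm C; lra.
suff : \forall n \near \oo, (1 <= n)%N /\ C' * `|c n| <= n%:R * eta /\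
    `|a| * (n%:R `^ b * (C' * `|c n|)) <= `|a| * (n%:R * eta).
  apply: filterS => n [n1 [h1 h2]]; split=> // m mn.
  have n0 : 0 < n%:R :> R by rewrite ltr0n.
  have mC' : `|m - n%:R| <= C' * `|c n| by apply: (le_trans mn); rewrite ler_wpM2r.
  have -> : m / n%:R - 1 = (m - n%:R) / n%:R by rewrite mulrBl divff// gt_eqF.
  rewrite normrM normfV (ger0_norm (ltW n0)) ler_pdivrMr//; split.
    by rewrite mulrC; apply: le_trans h1.
  rewrite !mulrA ler_pdivrMr// -mulrA [leRHS]mulrAC -[leRHS]mulrA.
  by apply: le_trans h2; rewrite ler_wpM2l// ler_wpM2l// powR_ge0.
have n1 : \forall n \near \oo, (1 <= n)%N by exists 1%N.
have e0 : 0 < eta / C' by rewrite divr_gt0.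
move: rate; rewrite /A2_rate; have [->|a0] := eqVneq a 0.
  move=> /eqoP/(_ _ e0) rate; apply: filterS2 n1 rate => n n1 cn.
  rewrite normr0 !mul0r; split=> //; split=> //.
  move: cn; rewrite (ger0_norm (ler0n _ n)) mulrAC ler_pdivlMr// => h.
  by rewrite mulrC [leRHS]mulrC.
move=> /eqoP/(_ _ e0) rate; apply: filterS2 n1 rate => n n1 cn.
have n0 : 0 < n%:R :> R by rewrite ltr0n.
(* As [n^b >= 1], the rate [o(n^(1-b))] also controls the ratio itself. *)
have nb1 : 1 <= n%:R `^ b :> R.
  by rewrite -[leLHS](powRr0 n%:R); apply: ler_powR; rewrite ?ler1n// ltW.
have nE : n%:R `^ b * n%:R `^ (1 - b) = n%:R :> R.
  rewrite -powRD; first by rewrite addrC subrK powRr1// ltW.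
  by apply/implyP => _; rewrite gt_eqF.
have main : n%:R `^ b * (C' * `|c n|) <= n%:R * eta.
  rewrite -[X in _ <= X * _]nE -mulrA ler_wpM2l ?powR_ge0//.
  move: cn; rewrite (ger0_norm (powR_ge0 _ _)) mulrAC ler_pdivlMr// => h.
  by rewrite mulrC [leRHS]mulrC.
split=> //; split; last by rewrite ler_wpM2l.
by apply: le_trans main; rewrite ler_peMl// mulr_ge0// ltW.
Qed.

End powR_asymptotics.

(** * Standardization as an affine map *)

Section standardize.
Context {R : realType} {d : nat}.
Implicit Types (a b m n : R) (g s : 'rV[R]_d).

Lemma standardize_affine a b m g :
  standardize a b m g = affine (m `^ b * m `^ (- a)) (- (m `^ b *: g)).
Proof. by apply/funext => s; rewrite /standardize /affine scalerBr scalerA. Qed.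

Lemma standardize_change a b m n g s : 0 < m -> 0 < n ->
  standardize a b m g s =
  affine ((m / n) `^ (b - a)) ((m `^ b * ((m / n) `^ (- a) - 1)) *: g)
    (standardize a b n g s).
Proof.
move=> m0 n0.
have mE x : (m / n) `^ x * n `^ x = m `^ x.
  by rewrite -powRM ?divr_ge0 ?(ltW m0) ?(ltW n0)// divfK// gt_eqF.
have rE : (m / n) `^ (b - a) = (m / n) `^ b * (m / n) `^ (- a).
  by rewrite powRD//; apply/implyP => _; rewrite gt_eqF// divr_gt0.
rewrite !standardize_affine /affine scalerDr scalerA -addrA; congr (_ + _).
  by congr (_ *: _); rewrite -(mE b) -(mE (- a)) rE; ring.
rewrite scalerN scalerA -scaleNr -scaleNr -scalerDl; congr (_ *: _).
by rewrite rE -(mE b); ring.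
Qed.

Lemma measurable_standardize a b m g : measurable_fun setT (standardize a b m g).
Proof. rewrite standardize_affine; exact: measurable_affine. Qed.

End standardize.

(** * Perturbing the sample size *)

Lemma lee_dist_trans (R : realType) (y x z : \bar R) (e1 e2 : R) :
  x \is a fin_num -> y \is a fin_num -> z \is a fin_num ->
  (`|x - y| <= e1%:E -> `|y - z| <= e2%:E -> `|x - z| <= (e1 + e2)%:E)%E.
Proof.
move=> xf yf zf; rewrite -(fineK xf) -(fineK yf) -(fineK zf) -!EFinB !lee_fin => h1 h2.
have -> : fine x - fine z = (fine x - fine y) + (fine y - fine z) by ring.
by apply: (le_trans (ler_normD _ _)); exact: lerD.
Qed.

Lemma lee_dist_sym (R : realType) (x y : \bar R) :
  x \is a fin_num -> y \is a fin_num -> (`|x - y| = `|y - x|)%E.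
Proof.
by move=> xf yf; rewrite -(fineK xf) -(fineK yf) -!EFinB /= distrC.
Qed.

Section sample_size_perturbation.
Context {R : realType} {d : nat} (L : nat -> probability 'rV[R]_d R)
  (X : probability 'rV[R]_d R) (SS : set (set 'rV[R]_d)).
Variables (a b : R) (g : 'rV[R]_d) (c : nat -> R).
Hypotheses (b0 : 0 < b) (rate : A2_rate a b c) (cX : continuous_law X).
Hypothesis SS_measurable : SS `<=` measurable.
Hypothesis SS_affine : forall (x : R) u S, 0 < x -> SS S -> SS (affine x u @^-1` S).
Hypothesis LX : forall e : R, 0 < e -> \forall n \near \oo, forall S, SS S ->
  (`|L n (standardize a b n%:R g @^-1` S) - X S| <= e%:E)%E.

Let mpre m S : SS S -> measurable (standardize a b m g @^-1` S).
Proof.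
move=> /SS_measurable mS; rewrite -[X in measurable X]setTI.
exact: measurable_standardize.
Qed.

Let fin n m S : SS S -> L n (standardize a b m g @^-1` S) \is a fin_num.
Proof. by move=> SSS; exact: (fin_num_measure _ _ (mpre _ SSS)). Qed.

Let finX S : SS S -> X S \is a fin_num.
Proof. by move=> SSS; exact: (fin_num_measure _ _ (SS_measurable SSS)). Qed.

(** Changing the standardizing size replaces [S] by a set of the class with almost the same limit
    probability. Passing from [m] to [n] serves a random scale, passing from [n] to [m] a random
    sample size; [n / 2 <= m] makes [m] large with [n]. *)
Let perturbation (C e : R) : 0 < e -> \forall n \near \oo, (1 <= n)%N /\
  forall m, `|m - n%:R| <= C * `|c n| -> [/\ n%:R / 2 <= m,
    forall S, SS S -> exists2 S', SS S' &
      standardize a b m g @^-1` S = standardize a b n%:R g @^-1` S' /\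
      (`|X S' - X S| <= e%:E)%E &
    forall S, SS S -> exists2 S', SS S' &
      standardize a b n%:R g @^-1` S = standardize a b m g @^-1` S' /\
      (`|X S' - X S| <= e%:E)%E].
Proof.
move=> e0; have [delta delta0 Xaff] := continuous_law_affine cX e0.
pose G := \sum_i `|g 0 i|.
have G0 : 0 <= G by rewrite sumr_ge0.
have gG i : `|g 0 i| <= G by rewrite /G (bigD1 i)//= lerDl sumr_ge0.
have [eta /andP[eta0 eta2] small] := powR_ratio_small a b0 G0 delta0.
apply: filterS (A2_rate_ratio C b0 rate eta0) => n [n1 ratio]; split=> // m mn.
have n0 : 0 < n%:R :> R by rewrite ltr0n.
have [r_eta qr_eta] := ratio m mn.
have [s1 s2 s3 s4] := small _ _ (powR_ge0 n%:R b) r_eta qr_eta.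
have m2 : n%:R / 2 <= m.
  move: r_eta; rewrite ler_norml => /andP[h _].
  have : 2^-1 <= m / n%:R by lra.
  by rewrite ler_pdivlMr// mulrC.
have m0 : 0 < m by apply: lt_le_trans m2; rewrite divr_gt0.
have shift_small t i : `|t| * G < delta -> `|(t *: g) 0 i| < delta.
  by apply: le_lt_trans; rewrite mxE normrM ler_wpM2l.
split=> // S SSS.
  exists (affine ((m / n%:R) `^ (b - a)) ((m `^ b * ((m / n%:R) `^ (- a) - 1)) *: g) @^-1` S).
    by apply: SS_affine => //; rewrite powR_gt0// divr_gt0.
  split; last first.
    apply: Xaff => //; last exact: SS_measurable.
    move=> i; apply: shift_small.
    by move: s3; rewrite -powRM ?divr_ge0 ?ltW// mulrC [n%:R * _]mulrC divfK ?gt_eqF// mulrC.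
  by apply/seteqP; split=> s /=; rewrite (standardize_change a b g s m0 n0).
exists (affine ((n%:R / m) `^ (b - a)) ((n%:R `^ b * ((n%:R / m) `^ (- a) - 1)) *: g) @^-1` S).
  by apply: SS_affine => //; rewrite powR_gt0// divr_gt0.
rewrite -invf_div; split; last first.
  apply: Xaff => //; last exact: SS_measurable.
  by move=> i; exact: shift_small.
by apply/seteqP; split=> s /=; rewrite (standardize_change a b g s n0 m0) invf_div.
Qed.

(** The law stays that of size [n] and only the scale is perturbed, as when standardizing with
    [n_dp]. *)
Lemma standardize_stable (C e : R) : 0 < e -> \forall n \near \oo,
  forall m, `|m - n%:R| <= C * `|c n| -> forall S, SS S ->
    (`|L n (standardize a b m g @^-1` S) - L n (standardize a b n%:R g @^-1` S)| <= e%:E)%E.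
Proof.
move=> e0; have e30 : 0 < e / 3 by rewrite divr_gt0.
apply: filterS2 (LX e30) (perturbation C e30) => n LXn [n1 pert] m mn S SSS.
have [_ + _] := pert m mn => /(_ _ SSS)[S' SSS' [-> XS']].
have -> : e = e / 3 + (e / 3 + e / 3) by field.
apply: (@lee_dist_trans _ (X S')); rewrite ?fin ?finX//; first exact: LXn.
apply: (@lee_dist_trans _ (X S)); rewrite ?fin ?finX//.
by rewrite lee_dist_sym ?fin ?finX//; exact: LXn.
Qed.

(** Here the law itself changes with [k] while the set stays fixed on the raw scale of [s]. *)
Lemma sample_size_stable (C e : R) : 0 < e -> \forall n \near \oo,
  forall k : nat, `|k%:R - n%:R| <= C * `|c n| -> forall S, SS S ->
    (`|L k S - L n S| <= e%:E)%E.
Proof.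
move=> e0; have e30 : 0 < e / 3 by rewrite divr_gt0.
have [N _ LXN] := LX e30.
(* Since [k >= n / 2], this puts both [k] and [n] beyond the rank [N] from which convergence is
   uniform. *)
have n2N : \forall n \near \oo, (2 * N <= n)%N by exists (2 * N)%N.
apply: filterS2 n2N (perturbation C e30) => n n2N [n1 pert] k kn S SSS.
have [kn2 _ step] := pert _ kn.
have Nn : (N <= n)%N by apply: leq_trans n2N; rewrite leq_pmull.
have Nk : (N <= k)%N.
  rewrite -(ler_nat R); apply: le_trans kn2; rewrite ler_pdivlMr//.
  by rewrite mulrC -natrM ler_nat.
have n0 : 0 < n%:R :> R by rewrite ltr0n.
have slope0 : 0 < n%:R `^ b * n%:R `^ (- a) :> R by rewrite mulr_gt0// powR_gt0.
(* [S1] is [S] read on the standardized scale of [n]; [S2] below is [S] read on that of [k], where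
   [L k] is close to [X]. *)
pose S1 := affine (n%:R `^ b * n%:R `^ (- a))^-1
  (- ((n%:R `^ b * n%:R `^ (- a))^-1 *: (- (n%:R `^ b *: g)))) @^-1` S.
have SSS1 : SS S1 by apply: SS_affine => //; rewrite invr_gt0.
have SE : S = standardize a b n%:R g @^-1` S1.
  by apply/seteqP; split=> s; rewrite /S1 /= standardize_affine affine_invK.
have [S2 SSS2 [S12 XS2]] := step _ SSS1.
have -> : L k S = L k (standardize a b k%:R g @^-1` S2) by rewrite -S12 -SE.
have -> : L n S = L n (standardize a b n%:R g @^-1` S1) by rewrite -SE.
have -> : e = e / 3 + (e / 3 + e / 3) by field.
apply: (@lee_dist_trans _ (X S2)); rewrite ?fin ?finX//; first exact: LXN.
apply: (@lee_dist_trans _ (X S1)); rewrite ?fin ?finX//.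
by rewrite lee_dist_sym ?fin ?finX//; exact: LXN.
Qed.

End sample_size_perturbation.

(** * Mixtures of almost constant probabilities *)

Section mixtures.
Context {R : realType}.
Local Open Scope ereal_scope.

(** On [B] two values of [[0, 1]] differ by at most 1, so [B] costs no more than its mass. *)
Lemma integral_dist_le d (Y : measurableType d) (Q : probability Y R)
    (f : Y -> \bar R) (v : \bar R) (B : set Y) (e1 e2 : R) :
  measurable_fun setT f -> (forall y, 0 <= f y <= 1) -> 0 <= v <= 1 ->
  measurable B -> (0 <= e1)%R -> Q B <= e2%:E ->
  (forall y, ~ B y -> `|f y - v| <= e1%:E) ->
  `|\int[Q]_y f y - v| <= (e1 + e2)%:E.
Proof.
move=> mf f01 /andP[v0 v1] mB e10 QB fv.
have fin01 (x : \bar R) : 0 <= x -> x <= 1 -> x \is a fin_num.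
  by move=> x0 x1; rewrite ge0_fin_numE// (le_lt_trans x1)// ltry.
have vfin := fin01 _ v0 v1.
have ffin y : f y \is a fin_num by have /andP[] := f01 y; exact: fin01.
have Q1 (r : \bar R) : \int[Q]_y (cst r y) = r.
  rewrite integral_cst// [X in _ * X](_ : _ = 1) ?mule1//; exact: probability_setT.
have le2 (f1 f2 : Y -> \bar R) : measurable_fun setT f1 -> measurable_fun setT f2 ->
    (forall y, 0 <= f1 y) -> (forall y, 0 <= f2 y) ->
    (forall y, f1 y <= f2 y + e1%:E + (\1_B y)%:E) ->
    \int[Q]_y f1 y <= \int[Q]_y f2 y + (e1 + e2)%:E.
  move=> mf1 mf2 f10 f20 f12.
  have m1B : measurable_fun setT (fun y => (\1_B y)%:E : \bar R) by exact/measurable_EFinP.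
  have m2e : measurable_fun setT (fun y => f2 y + e1%:E) by exact: emeasurable_funD.
  apply: (@le_trans _ _ (\int[Q]_y (f2 y + e1%:E + (\1_B y)%:E))).
    apply: ge0_le_integral => //; exact: emeasurable_funD.
  rewrite ge0_integralD//; last by move=> y _; rewrite adde_ge0// lee_fin.
  rewrite ge0_integralD//.
  rewrite (Q1 e1%:E) integral_indic// setIT EFinD addeA; exact: leeD.
have f0 y : 0 <= f y by have /andP[] := f01 y.
have I0 : 0 <= \int[Q]_y f y by exact: integral_ge0.
have I1 : \int[Q]_y f y <= 1.
  rewrite -[leRHS](Q1 1); apply: ge0_le_integral => // y _; by have /andP[] := f01 y.
have Ifin := fin01 _ I0 I1.
have upper : \int[Q]_y f y <= v + (e1 + e2)%:E.
  rewrite -[v]Q1; apply: le2 => // y; have [By|By] := pselect (B y).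
    rewrite indicE mem_set//; apply: (@le_trans _ _ 1); first by have /andP[] := f01 y.
    by rewrite leeDr// adde_ge0// lee_fin.
  rewrite indicE memNset// adde0; have := fv y By.
  rewrite -(fineK vfin) -(fineK (ffin y)) -!EFinD !lee_fin ler_norml => /andP[h1 h2]; lra.
have lower : v <= \int[Q]_y f y + (e1 + e2)%:E.
  rewrite -[v]Q1; apply: le2 => // y; have [By|By] := pselect (B y).
    rewrite indicE mem_set//; apply: (@le_trans _ _ 1) => //.
    by rewrite leeDr// adde_ge0// lee_fin.
  rewrite indicE memNset// adde0; have := fv y By.
  rewrite -(fineK vfin) -(fineK (ffin y)) -!EFinD !lee_fin ler_norml => /andP[h1 h2]; lra.
move: upper lower; rewrite -(fineK vfin) -(fineK Ifin) -!EFinD !lee_fin ler_norml => h1 h2.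
by apply/andP; split; lra.
Qed.

Lemma nneseries_dist_le (w : nat -> R) (f : nat -> \bar R) (v : \bar R)
    (B : set nat) (e1 e2 : R) :
  (forall k, (0 <= w k)%R) -> \sum_(1 <= k <oo) (w k)%:E = 1 ->
  (forall k, 0 <= f k <= 1) -> 0 <= v <= 1 -> (0 <= e1)%R ->
  \sum_(1 <= k <oo) (w k)%:E * (\1_B k)%:E <= e2%:E ->
  (forall k, ~ B k -> `|f k - v| <= e1%:E) ->
  `|\sum_(1 <= k <oo) (w k)%:E * f k - v| <= (e1 + e2)%:E.
Proof.
move=> w0 w1 f01 /andP[v0 v1] e10 wB fv.
have fin01 (x : \bar R) : 0 <= x -> x <= 1 -> x \is a fin_num.
  by move=> x0 x1; rewrite ge0_fin_numE// (le_lt_trans x1)// ltry.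
have vfin := fin01 _ v0 v1.
have ffin y : f y \is a fin_num by have /andP[] := f01 y; exact: fin01.
have wE0 k : 0 <= (w k)%:E by rewrite lee_fin.
have W1 (r : R) : (0 <= r)%R -> \sum_(1 <= k <oo) (w k)%:E * r%:E = r%:E.
  move=> r0; under eq_eseriesr do rewrite muleC.
  by rewrite nneseriesZl ?w1 ?mule1// => k _; rewrite ?lee_fin.
have le2 (f1 f2 : nat -> \bar R) : (forall k, 0 <= f1 k) -> (forall k, 0 <= f2 k) ->
    (forall k, f1 k <= f2 k + e1%:E + (\1_B k)%:E) ->
    \sum_(1 <= k <oo) (w k)%:E * f1 k <= \sum_(1 <= k <oo) (w k)%:E * f2 k + (e1 + e2)%:E.
  move=> f10 f20 f12.
  apply: (@le_trans _ _ (\sum_(1 <= k <oo)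
      ((w k)%:E * f2 k + (w k)%:E * e1%:E + (w k)%:E * (\1_B k)%:E))).
    apply: lee_nneseries => [k _ _|k _]; first exact: mule_ge0.
    rewrite -ge0_muleDr ?lee_fin// -ge0_muleDr ?adde_ge0 ?lee_fin//.
    by apply: lee_wpmul2l => //; exact: f12.
  rewrite nneseriesD; last 2 first.
  - by move=> k _ _; rewrite adde_ge0// mule_ge0 ?lee_fin.
  - by move=> k _ _; rewrite mule_ge0 ?lee_fin.
  rewrite nneseriesD; last 2 first.
  - by move=> k _ _; rewrite mule_ge0.
  - by move=> k _ _; rewrite mule_ge0 ?lee_fin.
  by rewrite W1// EFinD addeA leeD2l.
have f0 y : 0 <= f y by have /andP[] := f01 y.
have I0 : 0 <= \sum_(1 <= k <oo) (w k)%:E * f k.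
  by apply: nneseries_ge0 => k _ _; exact: mule_ge0.
have I1 : \sum_(1 <= k <oo) (w k)%:E * f k <= 1.
  rewrite -w1; apply: lee_nneseries => [k _ _|k _]; first exact: mule_ge0.
  by rewrite -[leRHS]mule1; apply: lee_wpmul2l => //; have /andP[] := f01 k.
have Ifin := fin01 _ I0 I1.
have vE : v = \sum_(1 <= k <oo) (w k)%:E * v by rewrite -(fineK vfin) W1 ?fine_ge0.
have upper : \sum_(1 <= k <oo) (w k)%:E * f k <= v + (e1 + e2)%:E.
  rewrite [in leRHS]vE; apply: le2 => // y; have [By|By] := pselect (B y).
    rewrite indicE mem_set//; apply: (@le_trans _ _ 1); first by have /andP[] := f01 y.
    by rewrite leeDr// adde_ge0// lee_fin.
  rewrite indicE memNset// adde0; have := fv y By.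
  rewrite -(fineK vfin) -(fineK (ffin y)) -!EFinD !lee_fin ler_norml => /andP[h1 h2]; lra.
have lower : v <= \sum_(1 <= k <oo) (w k)%:E * f k + (e1 + e2)%:E.
  rewrite [in leLHS]vE; apply: le2 => // y; have [By|By] := pselect (B y).
    rewrite indicE mem_set//; apply: (@le_trans _ _ 1) => //.
    by rewrite leeDr// adde_ge0// lee_fin.
  rewrite indicE memNset// adde0; have := fv y By.
  rewrite -(fineK vfin) -(fineK (ffin y)) -!EFinD !lee_fin ler_norml => /andP[h1 h2]; lra.
move: upper lower; rewrite -(fineK vfin) -(fineK Ifin) -!EFinD !lee_fin ler_norml => h1 h2.
by apply/andP; split; lra.
Qed.

End mixtures.

(** * Laws of the model *)

Section model_laws.
Context {R : realType} {p d : nat} {dT : measure_display} {T : measurableType dT}.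
Variable M : dp_model R p d T.
Implicit Types (n : nat) (theta : 'rV[R]_p).

Lemma s_law_setT n theta : s_law M n theta setT = 1%E.
Proof.
transitivity (\int[data_ker M n theta]__ (1 : \bar R))%E.
  by apply: eq_integral => x _; exact: prob_kernel.
rewrite integral_cst// mul1e; exact: prob_kernel.
Qed.

(** A separate name for [s_law], to carry the structure of a probability. *)
Definition s_prob n theta : set 'rV[R]_d -> \bar R := s_law M n theta.

HB.instance Definition _ n theta := Measure.on (s_prob n theta).

HB.instance Definition _ n theta := Measure_isProbability.Build _ _ _
  (s_prob n theta) (s_law_setT n theta).

Definition std_prob a b (g : 'rV[R]_p -> 'rV[R]_d) n theta : probability 'rV[R]_d R :=
  distribution (s_prob n theta)
    (mfun_Sub (mem_set (measurable_standardize a b n%:R (g theta)))).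

Lemma measurable_s_law n (S : set 'rV[R]_d) : measurable S ->
  measurable_fun setT (fun theta => s_law M n theta S).
Proof.
exact: (measurable_kernel (mkcomp_noparam (data_ker M n) (summary_ker M n))).
Qed.

Lemma measurable_s_law_xsection n (W : set ('rV[R]_p * 'rV[R]_d)) : measurable W ->
  measurable_fun setT (fun theta => s_law M n theta (xsection W theta)).
Proof.
move=> mW; pose k : R.-fker _ ~> _ := mkcomp_noparam (data_ker M n) (summary_ker M n).
by apply: (measurable_fun_xsection_finite_kernel k); rewrite inE.
Qed.

Lemma measurable_s_law_integral n (h : 'rV[R]_p * 'rV[R]_d -> \bar R) :
  (forall z, 0 <= h z)%E -> measurable_fun setT h ->
  measurable_fun setT (fun theta => \int[s_law M n theta]_s h (theta, s))%E.
Proof.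
move=> h0 mh; pose k : R.-fker _ ~> _ := mkcomp_noparam (data_ker M n) (summary_ker M n).
exact: (@measurable_fun_integral_finite_kernel _ _ _ _ _ h k).
Qed.

End model_laws.

Lemma measurable_row_mx (R : realType) p d :
  measurable_fun setT (fun tv : 'rV[R]_p * 'rV[R]_d => row_mx tv.1 tv.2).
Proof.
apply: measurable_fun_coordP => i j; case: (split_ordP j) => k ->.
  rewrite (_ : (fun _ => _) = (fun v : 'rV[R]_p => v i k : R) \o fst).
    by apply: measurableT_comp => //; exact: measurable_coord.
  by apply/funext => tv /=; rewrite row_mxEl.
rewrite (_ : (fun _ => _) = (fun v : 'rV[R]_d => v i k : R) \o snd).
  by apply: measurableT_comp => //; exact: measurable_coord.
by apply/funext => tv /=; rewrite row_mxEr.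
Qed.

Lemma measurable_row_section (R : realType) p d (theta : 'rV[R]_p)
    (S : set 'rV[R]_(p + d)) : measurable S ->
  measurable [set v : 'rV[R]_d | S (row_mx theta v)].
Proof.
move=> mS; rewrite (_ : [set _ | _] =
    xsection ((fun tv : 'rV[R]_p * 'rV[R]_d => row_mx tv.1 tv.2) @^-1` S) theta).
  apply: measurable_xsection; rewrite -[X in measurable X]setTI.
  exact: measurable_row_mx.
by apply/seteqP; split=> v; rewrite /xsection /= inE.
Qed.

Lemma measurable_standardize_param d0 (X : measurableType d0) (R : realType) d (a b : R)
    (m : X -> R) (g s : X -> 'rV[R]_d) :
  measurable_fun setT m -> measurable_fun setT g -> measurable_fun setT s ->
  measurable_fun setT (fun x => standardize a b (m x) (g x) (s x)).
Proof.
move=> mm mg ms; apply: measurable_fun_coordP => i j.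
rewrite (_ : (fun _ => _) =
    (fun x => m x `^ b * (m x `^ (- a) * s x i j - g x i j))); last first.
  by apply/funext => x; rewrite /standardize !mxE.
have mpow e : measurable_fun setT (fun x => m x `^ e).
  by apply: (measurableT_comp (measurable_powR e)).
have coord (f : X -> 'rV[R]_d) : measurable_fun setT f ->
  measurable_fun setT (fun x => f x i j).
  by move=> mf; apply: (measurableT_comp (@measurable_coord _ R 1 d i j)).
apply: measurable_funM => //; apply: measurable_funB; last exact: coord.
by apply: measurable_funM => //; exact: coord.
Qed.

(* Since [n^-a s - g] is of order [n^-b], the event below has probability close
   to 1 or to 0 according to the side of [q] on which [g i] lies. *)
Lemma coordinate_dichotomy (R : realType) d (L : nat -> probability 'rV[R]_d R)
    (X : probability 'rV[R]_d R) (a b : R) (g : 'rV[R]_d) : 0 < b ->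
  (forall e : R, 0 < e -> \forall n \near \oo, forall S, rectangle S ->
    (`|L n (standardize a b n%:R g @^-1` S) - X S| <= e%:E)%E) ->
  forall i (q : R),
    (g 0 i < q -> \forall n \near \oo,
      (2^-1%:E < L n [set s | (n%:R `^ (- a) * s 0 i <= q)%R])%E) /\
    (q < g 0 i -> \forall n \near \oo,
      ~ (2^-1%:E < L n [set s | (n%:R `^ (- a) * s 0 i <= q)%R])%E).
Proof.
move=> b0 LX i q.
(* When the standardized vector lies in this slab, coordinate [i] of [n^-a s] is within [K n^-b] of
   that of [g]. *)
pose H (K : nat) : set 'rV[R]_d := (fun v => v 0 i) @^-1` `[- K%:R, K%:R]%classic.
have rH K : rectangle (H K).
  exists (fun j => if j == i then `[- K%:R, K%:R] else `]-oo, +oo[).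
  apply/seteqP; split=> v /= Hv.
    by move=> j; case: eqP => [->//|_]; rewrite in_itv.
  by have := Hv i; rewrite eqxx.
have mH K := measurable_rectangle (rH K).
have mcoord : measurable_fun setT (fun v : 'rV[R]_d => v 0 i : R).
  exact: (@measurable_coord _ R 1 d 0 i).
have [K XK] : exists K, ((7 / 8)%R%:E <= X (H K))%E.
  have cvgH : X (H K) @[K --> \oo] --> X (\bigcup_K H K).
    apply: nondecreasing_cvg_mu => //; first exact: bigcupT_measurable.
    move=> m n mn; apply/subsetPset => v; rewrite /H /= !in_itv /= => /andP[h1 h2].
    have mnR : m%:R <= n%:R :> R by rewrite ler_nat.
    by apply/andP; split; lra.
  have HT : \bigcup_K H K = setT.
    apply/seteqP; split=> // v _; exists (Num.truncn `|v 0 i|).+1 => //.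
    rewrite /H /= in_itv /=; have := truncnS_gt `|v 0 i|.
    by rewrite ltr_norml => /andP[/ltW-> /ltW->].
  rewrite HT probability_setT in cvgH.
  have e0 : 0 < 8^-1 :> R by [].
  have [K _ /(_ _ (leqnn K))[_ h]] := cvge_near cvgH e0; exists K.
  move: h; rewrite -(fineK (fin_num_measure X _ (mH K))) -EFinD !lee_fin; lra.
have pow_large eta : 0 < eta -> \forall n \near \oo, (1 <= n)%N /\ K%:R < eta * n%:R `^ b.
  move=> eta0; exists (Num.truncn ((K%:R / eta + 1) `^ b^-1)).+1 => // n /= hn.
  have n1 : (1 <= n)%N by apply: leq_trans hn.
  have Keta : 0 <= K%:R / eta by rewrite divr_ge0// ltW.
  split=> //; rewrite mulrC -ltr_pdivrMr//.
  apply: (@lt_le_trans _ _ (K%:R / eta + 1)); first by rewrite ltrDl.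
  have -> : K%:R / eta + 1 = ((K%:R / eta + 1) `^ b^-1) `^ b.
    by rewrite -powRrM mulVf ?gt_eqF// powRr1// addr_ge0.
  apply: ge0_ler_powR; rewrite ?nnegrE ?powR_ge0 ?(ltW b0)//.
  by apply: (le_trans (ltW (truncnS_gt _))); rewrite ler_nat.
(* From [7/8 - 1/8]. If [g i < q], the slab event lies inside the event studied; if [q < g i], the
   two are disjoint, which leaves at most [1/4]. *)
have near_H : \forall n \near \oo, ((3 / 4)%R%:E <= L n (standardize a b n%:R g @^-1` H K))%E.
  have e0 : 0 < 8^-1 :> R by [].
  apply: filterS (LX _ e0) => n /(_ _ (rH K)).
  have mHn : measurable (standardize a b n%:R g @^-1` H K).
    by rewrite -[X in measurable X]setTI; exact: measurable_standardize.
  move: XK; rewrite -(fineK (fin_num_measure X _ (mH K))) -(fineK (fin_num_measure (L n) _ mHn)).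
  by rewrite -EFinB !lee_fin ler_norml => h1 /andP[h2 h3]; lra.
pose B n := [set s : 'rV[R]_d | (n%:R `^ (- a) * s 0 i <= q)%R].
have mB n : measurable (B n).
  rewrite (_ : B n = (fun s : 'rV[R]_d => n%:R `^ (- a) * s 0 i) @^-1` `]-oo, q]%classic).
    by rewrite -[X in measurable X]setTI; apply: measurable_funM.
  by apply/seteqP; split=> s; rewrite /B /= in_itv.
have mHn n : measurable (standardize a b n%:R g @^-1` H K).
  by rewrite -[X in measurable X]setTI; exact: measurable_standardize.
have Hn_bound n s : (standardize a b n%:R g @^-1` H K) s ->
    - K%:R <= n%:R `^ b * (n%:R `^ (- a) * s 0 i - g 0 i) <= K%:R.
  by rewrite /H /= in_itv /= /standardize !mxE.
split=> gq.
  have eta0 : 0 < q - g 0 i by rewrite subr_gt0.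
  apply: filterS2 (pow_large _ eta0) near_H => n [n1 Kn] HL.
  apply: (@lt_le_trans _ _ (3 / 4)%R%:E); first by rewrite lte_fin; lra.
  apply: (le_trans HL); apply: le_measure; rewrite ?inE; [exact: mHn|exact: mB|].
  move=> s /Hn_bound /andP[_ h]; have nb0 : 0 < n%:R `^ b :> R by rewrite powR_gt0// ltr0n.
  have : n%:R `^ b * (n%:R `^ (- a) * s 0 i - g 0 i) < n%:R `^ b * (q - g 0 i).
    by rewrite [ltRHS]mulrC; exact: le_lt_trans h Kn.
  by rewrite ltr_pM2l//= ltrD2r => /ltW.
have eta0 : 0 < g 0 i - q by rewrite subr_gt0.
apply: filterS2 (pow_large _ eta0) near_H => n [n1 Kn] HL.
have : (L n (B n `|` standardize a b n%:R g @^-1` H K) <= 1)%E.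
  by apply: probability_le1; exact: measurableU.
have -> : (L n (B n `|` standardize a b n%:R g @^-1` H K) =
    L n (B n) + L n (standardize a b n%:R g @^-1` H K))%E.
  rewrite measureU//; apply/seteqP; split=> // s [/= Bs /Hn_bound /andP[h _]].
  have nb0 : 0 < n%:R `^ b :> R by rewrite powR_gt0// ltr0n.
  have : n%:R `^ b * (n%:R `^ (- a) * s 0 i - g 0 i) <= n%:R `^ b * (q - g 0 i).
    by rewrite ler_pM2l// lerD2r.
  by move: Kn; rewrite [_ * _ `^ _]mulrC; nra.
move: HL; rewrite -(fineK (fin_num_measure (L n) _ (mB n))).
rewrite -(fineK (fin_num_measure (L n) _ (mHn n))).
by rewrite -EFinD !lee_fin lte_fin => h1 h2 h3; lra.
Qed.

(** * Dominated convergence uniformly over a class *)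

Lemma ge0_cvge0 (R : realType) (u : nat -> \bar R) : (forall n, (0 <= u n)%E) ->
  (forall e : R, 0 < e -> \forall n \near \oo, (u n <= e%:E)%E) -> u @ \oo --> 0%E.
Proof.
move=> u0 ue; apply/fine_cvgP; split.
  by apply: filterS (ue 1 ltr01) => n un; rewrite ge0_fin_numE// (le_lt_trans un)// ltry.
apply/cvgrPdist_le => e e0; apply: filterS (ue e e0) => n un /=.
have un_fin : u n \is a fin_num by rewrite ge0_fin_numE// (le_lt_trans un)// ltry.
by rewrite sub0r normrN ger0_norm ?fine_ge0// -lee_fin fineK.
Qed.

(* At every [n] it suffices to treat one index violating the bound [e], if
   there is any; dominated convergence then applies to this sequence, so no
   measurability of the supremum over [D] is needed. *)
Lemma uniform_integral_dist (R : realType) d (Y : measurableType d)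
    (mu : {measure set Y -> \bar R}) (E : set Y) (I : Type) (D : set I)
    (f1 f2 : nat -> I -> Y -> \bar R) :
  measurable E -> (mu E < +oo)%E -> D !=set0 ->
  (forall n i, (1 <= n)%N -> D i ->
    measurable_fun E (f1 n i) /\ measurable_fun E (f2 n i)) ->
  (forall n i y, (1 <= n)%N -> D i -> E y ->
    (0 <= f1 n i y <= 1 /\ 0 <= f2 n i y <= 1)%E) ->
  (forall y, E y -> forall e : R, 0 < e -> \forall n \near \oo, forall i, D i ->
    (`|f1 n i y - f2 n i y| <= e%:E)%E) ->
  forall e : R, 0 < e -> \forall n \near \oo, forall i, D i ->
    (`|\int[mu]_(y in E) f1 n i y - \int[mu]_(y in E) f2 n i y| <= e%:E)%E.
Proof.
move=> mE Eoo [i0 Di0] mf f01 f12 e e0.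
pose dist n i := (`|\int[mu]_(y in E) f1 n i y - \int[mu]_(y in E) f2 n i y|)%E.
have worst n : exists i, D i /\ ((dist n i <= e%:E)%E -> forall j, D j ->
  (dist n j <= e%:E)%E).
  have [[i [Di di]]|all_small] := pselect (exists i, D i /\ ~ (dist n i <= e%:E)%E).
    by exists i; split.
  exists i0; split=> // _ j Dj; apply/negPn/negP => dj; apply: all_small.
  by exists j; split=> //; exact/negP.
have [idx /all_and2[Didx idxP]] := choice worst.
(* The shift by one skips the index 0, about which nothing is assumed. *)
pose h n y := (`|f1 n.+1 (idx n.+1) y - f2 n.+1 (idx n.+1) y|)%E.
have fin01 (x : \bar R) : (0 <= x)%E -> (x <= 1)%E -> x \is a fin_num.
  by move=> x0 x1; rewrite ge0_fin_numE// (le_lt_trans x1)// ltry.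
have mh n : measurable_fun E (h n).
  have [m1 m2] := mf n.+1 _ (ltn0Sn _) (Didx n.+1).
  by apply: measurableT_comp => //; exact: emeasurable_funB.
have h0 n y : (0 <= h n y)%E by exact: abse_ge0.
have h_cvg y : E y -> h n y @[n --> \oo] --> 0%E.
  move=> Ey; apply: ge0_cvge0 => // x x0; have [N _ hN] := f12 y Ey x x0.
  by exists N => // n /= Nn; apply: hN => //=; exact: leqW.
have h1 n y : E y -> (h n y <= 1)%E.
  move=> Ey; have [/andP[a0 a1] /andP[b0 b1]] := f01 _ _ y (ltn0Sn n) (Didx n.+1) Ey.
  have fa := fin01 _ a0 a1; have fb := fin01 _ b0 b1.
  move: a0 a1 b0 b1; rewrite /h -(fineK fa) -(fineK fb).
  rewrite -EFinB !lee_fin ler_norml => *; by apply/andP; split; lra.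
have [_ _] : [/\ mu.-integrable E (cst 0%E),
    [sequence (\int[mu]_(y in E) `|h n y - cst 0 y|)%E]_n @ \oo --> 0%E &
    [sequence (\int[mu]_(y in E) h n y)%E]_n @ \oo --> (\int[mu]_(y in E) cst 0 y)%E].
  apply: (@dominated_convergence _ _ _ mu E mE h (cst 0%E) (cst 1%E)) => //.
  - by apply: aeW => y Ey; exact: h_cvg.
  - apply/integrableP; split; first exact: measurable_cst.
    under eq_integral do rewrite /= normr1.
    by rewrite integral_cst// mul1e.
  - by apply: aeW => y n Ey; rewrite gee0_abs//; exact: h1.
rewrite integral0 => /cvge_near/(_ _ e0)[N _ hN].
exists N.+1 => // -[//|n] /= Nn; apply: (idxP n.+1).
have {hN} [hn _] := hN n Nn; rewrite add0e in hn.
have [m1 m2] := mf n.+1 _ (ltn0Sn _) (Didx n.+1).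
have bounds y : E y -> _ := f01 n.+1 (idx n.+1) y (ltn0Sn _) (Didx n.+1).
have int_fin (f : Y -> \bar R) : measurable_fun E f ->
    (forall y, E y -> (0 <= f y <= 1)%E) -> (\int[mu]_(y in E) f y)%E \is a fin_num.
  move=> mf' f'01; rewrite ge0_fin_numE; last first.
    by apply: integral_ge0 => y /f'01 /andP[].
  apply: (@le_lt_trans _ _ (\int[mu]_(y in E) 1)%E).
    by apply: ge0_le_integral => // y /f'01 /andP[].
  by rewrite integral_cst// mul1e.
have le_int (k1 k2 : Y -> \bar R) : measurable_fun E k1 -> measurable_fun E k2 ->
    (forall y, E y -> (0 <= k1 y <= 1)%E) -> (forall y, E y -> (0 <= k2 y <= 1)%E) ->
    (forall y, E y -> (`|k1 y - k2 y| = h n y)%E) ->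
    (\int[mu]_(y in E) k1 y <= \int[mu]_(y in E) k2 y + e%:E)%E.
  move=> mk1 mk2 k101 k201 k12.
  apply: (@le_trans _ _ (\int[mu]_(y in E) (k2 y + h n y))%E).
    apply: ge0_le_integral => //; try by move=> y /k101 /andP[].
      exact: emeasurable_funD.
    move=> y Ey; rewrite -k12//; have /andP[a0 a1] := k101 y Ey;
      have /andP[b0 b1] := k201 y Ey.
    rewrite -(fineK (fin01 _ a0 a1)) -(fineK (fin01 _ b0 b1)) -EFinB -EFinD lee_fin.
    by rewrite -lerBlDl ler_norm.
  rewrite ge0_integralD//; try by move=> y /k201 /andP[].
  exact: leeD.
have k12 : (\int[mu]_(y in E) f1 n.+1 (idx n.+1) y <=
    \int[mu]_(y in E) f2 n.+1 (idx n.+1) y + e%:E)%E.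
  by apply: le_int => // y Ey; have [] := bounds y Ey.
have k21 : (\int[mu]_(y in E) f2 n.+1 (idx n.+1) y <=
    \int[mu]_(y in E) f1 n.+1 (idx n.+1) y + e%:E)%E.
  apply: le_int => // y Ey; have [] // := bounds y Ey.
  move=> /andP[a0 a1] /andP[b0 b1]; apply: lee_dist_sym; exact: fin01.
have fin1 : (\int[mu]_(y in E) f1 n.+1 (idx n.+1) y)%E \is a fin_num.
  by apply: int_fin => // y Ey; have [] := bounds y Ey.
have fin2 : (\int[mu]_(y in E) f2 n.+1 (idx n.+1) y)%E \is a fin_num.
  by apply: int_fin => // y Ey; have [] := bounds y Ey.
move: k12 k21; rewrite /dist -(fineK fin1) -(fineK fin2) -EFinB -!EFinD !lee_fin ler_norml.
by move=> h2 h3; apply/andP; split; lra.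
Qed.

(** * Convergence for a fixed parameter *)

Section convergence.
Context {R : realType} {p d : nat} {dT : measure_display} {T : measurableType dT}.
Variables (M : dp_model R p d T) (a b : R) (g : 'rV[R]_p -> 'rV[R]_d) (c : nat -> R).
Variable SS : set (set 'rV[R]_d).
Hypotheses (b0 : 0 < b) (SS_measurable : SS `<=` measurable)
  (SS_affine : forall (x : R) u S, 0 < x -> SS S -> SS (affine x u @^-1` S)).
Hypothesis std_cvg : forall theta, Theta M theta ->
  exists2 X : probability 'rV[R]_d R, continuous_law X & forall e : R, 0 < e ->
    \forall n \near \oo, forall S, SS S ->
      (`|std_n_law M a b g n theta S - X S| <= e%:E)%E.

(** The product measure integrates over [s] on the outside; exchanging the order exhibits a mixture
    over [n_dp]. *)
Lemma std_ndp_lawE n theta S : measurable S ->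
  std_ndp_law M a b g n theta S =
  (\int[ndp_law M n]_m s_law M n theta (standardize a b m (g theta) @^-1` S))%E.
Proof.
move=> mS; pose V (sm : 'rV[R]_d * measurableTypeR R) := standardize a b sm.2 (g theta) sm.1.
have mV : measurable_fun setT V.
  by apply: measurable_standardize_param => //; exact: measurable_cst.
have mW : measurable (V @^-1` S) by rewrite -[X in measurable X]setTI; exact: mV.
transitivity ((s_prob M n theta \x^ ndp_law M n)%E (V @^-1` S)).
  exact: (product_measure12E (s_prob M n theta) (ndp_law M n) mW).
apply: eq_integral => m _ /=; congr (s_law M n theta _).
by apply/seteqP; split=> s; rewrite /ysection /= inE.
Qed.

Lemma measurable_s_law_standardize n theta S : measurable S ->
  measurable_fun setT (fun m : measurableTypeR R =>
    s_law M n theta (standardize a b m (g theta) @^-1` S)).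
Proof.
move=> mS; pose V (sm : 'rV[R]_d * measurableTypeR R) := standardize a b sm.2 (g theta) sm.1.
have mV : measurable_fun setT V.
  by apply: measurable_standardize_param => //; exact: measurable_cst.
have mW : measurable (V @^-1` S) by rewrite -[X in measurable X]setTI; exact: mV.
rewrite (_ : (fun _ => _) = s_prob M n theta \o ysection (V @^-1` S)).
  exact: measurable_fun_ysection.
apply/funext => m /=; congr (s_law M n theta _).
by apply/seteqP; split=> s; rewrite /ysection /= inE.
Qed.

Lemma s_law01 n theta S : measurable S -> (0 <= s_law M n theta S <= 1)%E.
Proof.
move=> mS; rewrite measure_ge0 /=; exact: (@probability_le1 _ _ _ (s_prob M n theta)).
Qed.

Let mstd m theta S : measurable S -> measurable (standardize a b m (g theta) @^-1` S).
Proof.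
by move=> mS; rewrite -[X in measurable X]setTI; exact: measurable_standardize.
Qed.

Lemma std_ndp_law01 n theta S : measurable S ->
  (0 <= std_ndp_law M a b g n theta S <= 1)%E.
Proof.
move=> mS; rewrite std_ndp_lawE//; apply/andP; split.
  by apply: integral_ge0 => m _; have /andP[] := s_law01 n theta (mstd m theta mS).
apply: (@le_trans _ _ (\int[ndp_law M n]_m 1)%E).
  apply: ge0_le_integral => //.
  + exact: measurable_s_law_standardize.
  + by move=> m _; have /andP[] := s_law01 n theta (mstd m theta mS).
rewrite integral_cst// mul1e; exact: probability_le1.
Qed.

Let LX theta : Theta M theta ->
  exists2 X : probability 'rV[R]_d R, continuous_law X & forall e : R, 0 < e ->
    \forall n \near \oo, forall S, SS S ->
      (`|s_prob M n theta (standardize a b n%:R (g theta) @^-1` S) - X S| <= e%:E)%E.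
Proof. exact: std_cvg. Qed.

Lemma std_ndp_close : A2a M a b c -> forall theta, Theta M theta ->
  forall e : R, 0 < e -> \forall n \near \oo, forall S, SS S ->
  (`|std_n_law M a b g n theta S - std_ndp_law M a b g n theta S| <= e%:E)%E.
Proof.
move=> [rate _ bigO] theta Theta_theta e e0; have e20 : 0 < e / 2 by rewrite divr_gt0.
have [X cX LXn] := LX Theta_theta; have [C Cn] := bigO _ e20.
have stable := standardize_stable b0 rate cX SS_measurable SS_affine LXn C e20.
apply: filterS2 Cn stable => n Cn stable_n S SSS.
have mS := SS_measurable SSS.
pose B : set (measurableTypeR R) :=
  (fun m : R => m - n%:R) @^-1` [set y | (C * `|c n| < `|y|)%R].
have mB : measurable B.
  rewrite (_ : B = (fun m : R => `|m - n%:R|) @^-1` `]C * `|c n|, +oo[%classic).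
    rewrite -[X in measurable X]setTI;
      apply: (measurableT_comp (@normr_measurable R setT)) => //.
    by apply: measurable_funB => //; exact: measurable_cst.
  by apply/seteqP; split=> m; rewrite /B /= in_itv /= andbT.
rewrite (splitr e) lee_dist_sym.
- rewrite std_ndp_lawE//; apply: (@integral_dist_le _ _ _ _ _ _ B) => //.
  + exact: measurable_s_law_standardize.
  + by move=> m; apply: s_law01; exact: mstd.
  + by apply: s_law01; exact: mstd.
  + exact: ltW.
  + move=> m /negP; rewrite -leNgt => mn; exact: stable_n.
- by apply: (@fin_num_measure _ _ _ (s_prob M n theta)); exact: mstd.
- by have /andP[h0 h1] := std_ndp_law01 n theta mS;
  rewrite ge0_fin_numE// (le_lt_trans h1)// ltry.
Qed.

Lemma posterior_ge0 y k : 0 <= posterior M y k.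
Proof.
have w0 j : (0 <= (ndp_dens M j y * size_prior M j)%:E)%E.
  by rewrite lee_fin mulr_ge0// ?ndp_dens_ge0 ?size_prior_ge0.
rewrite /posterior divr_ge0//; first by rewrite -lee_fin.
by apply/fine_ge0/nneseries_ge0 => j _ _.
Qed.

Lemma posterior_sum y : (0 < evidence M y < +oo)%E ->
  (\sum_(1 <= k <oo) (posterior M y k)%:E = 1)%E.
Proof.
move=> /andP[ev0 evoo].
have ev_fin : evidence M y \is a fin_num by rewrite ge0_fin_numE// ltW.
have fev0 : 0 < fine (evidence M y) by rewrite -lte_fin fineK.
under eq_eseriesr do rewrite /posterior mulrC EFinM.
rewrite nneseriesZl => [|k _]; last first.
  by rewrite lee_fin mulr_ge0 ?ndp_dens_ge0 ?size_prior_ge0.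
by rewrite -/(evidence M y) -(fineK ev_fin) -EFinM mulVf// gt_eqF.
Qed.

Lemma given_ndp01 U (K : nat -> set U -> \bar R) n0 S :
  (0 < evidence M n0%:R < +oo)%E -> (forall k, (0 <= K k S <= 1)%E) ->
  (0 <= given_ndp M K n0%:R S <= 1)%E.
Proof.
move=> ev K01; have K0 k : (0 <= K k S)%E by have /andP[] := K01 k.
apply/andP; split.
  by apply: nneseries_ge0 => k _ _; rewrite mule_ge0// lee_fin posterior_ge0.
rewrite -(posterior_sum ev); apply: lee_nneseries => [k _ _|k _].
  by rewrite mule_ge0// lee_fin posterior_ge0.
rewrite -[leRHS]mule1; apply: lee_wpmul2l; first by rewrite lee_fin posterior_ge0.
by have /andP[] := K01 k.
Qed.

Lemma given_ndp_close : A2b M a b c -> forall theta, Theta M theta ->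
  forall e : R, 0 < e -> \forall n0 \near \oo, forall S, SS S ->
  (`|s_law M n0 theta S - given_ndp M (fun k => s_law M k theta) n0%:R S| <= e%:E)%E.
Proof.
move=> [rate ev bigO] theta Theta_theta e e0; have e20 : 0 < e / 2 by rewrite divr_gt0.
have [X cX LXn] := LX Theta_theta; have [C Cn] := bigO _ e20.
have stable := sample_size_stable b0 rate cX SS_measurable SS_affine LXn C e20.
have n1 : \forall n \near \oo, (1 <= n)%N by exists 1%N.
apply: filterS3 n1 Cn stable => n n1 Cn stable_n S SSS.
have mS := SS_measurable SSS; have ev_n := ev n n1.
pose B := [set k : nat | (C * `|c n| < `|k%:R - n%:R|)%R].
rewrite (splitr e) lee_dist_sym.
- apply: (@nneseries_dist_le _ _ _ _ B).
  + exact: posterior_ge0.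
  + exact: posterior_sum.
  + by move=> k; exact: s_law01.
  + exact: s_law01.
  + exact: ltW.
  (* The O_p hypothesis is stated with Dirac masses, whose values on the tail set are the indicators
     of [B]. *)
  + apply: le_trans Cn; rewrite le_eqVlt; apply/orP; left; apply/eqP.
    by apply: eq_eseriesr => k _; congr (_ * _)%E; rewrite diracE indicE.
  + by move=> k /negP; rewrite -leNgt => kn; exact: stable_n.
- exact: (@fin_num_measure _ _ _ (s_prob M n theta)).
- have /andP[h0 h1] : (0 <= given_ndp M (fun k => s_law M k theta) n%:R S <= 1)%E.
    by apply: given_ndp01 => // k; exact: s_law01.
  by rewrite ge0_fin_numE// (le_lt_trans h1)// ltry.
Qed.

End convergence.

(** * Convergence of the joint laws *)

Section joint_convergence.
Context {R : realType} {p d : nat} {dT : measure_display} {T : measurableType dT}.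
Variables (M : dp_model R p d T) (a b : R) (g : 'rV[R]_p -> 'rV[R]_d) (c : nat -> R).
Variables (SS : set (set 'rV[R]_d)) (SS' : set (set 'rV[R]_(p + d))).
Hypotheses (b0 : 0 < b) (SS_measurable : SS `<=` measurable)
  (SS_rectangle : rectangle `<=` SS)
  (SS_affine : forall (x : R) u S, 0 < x -> SS S -> SS (affine x u @^-1` S)).
Hypotheses (SS'_measurable : SS' `<=` measurable) (SS'_T : SS' setT)
  (SS'_section : forall S theta, SS' S -> SS [set v | S (row_mx theta v)]).
Hypothesis std_cvg : forall theta, Theta M theta ->
  exists2 X : probability 'rV[R]_d R, continuous_law X & forall e : R, 0 < e ->
    \forall n \near \oo, forall S, SS S ->
      (`|std_n_law M a b g n theta S - X S| <= e%:E)%E.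
Hypothesis proper : proper_prior M.

Let mTheta := measurable_Theta M.

Let coord_g i theta : R := g theta 0 i.

Lemma measurable_location i : measurable_fun (Theta M) (coord_g i).
Proof.
apply: (measurability _ (RGenInftyO.measurableE R)) => //= _ [_ [t ->] <-].
pose H n (q : R) := [set s : 'rV[R]_d | (n%:R `^ (- a) * s 0 i <= q)%R].
have mH n q : measurable (H n q).
  rewrite (_ : H n q = (fun s : 'rV[R]_d => n%:R `^ (- a) * s 0 i) @^-1` `]-oo, q]%classic).
    rewrite -[X in measurable X]setTI; apply: measurable_funM => //.
    exact: (@measurable_coord _ R 1 d 0 i).
  by apply/seteqP; split=> s; rewrite /H /= in_itv.
(* The levels stay strictly below [t], since the dichotomy is silent when coordinate [i] of [g]
   equals the level. *)
pose q k := t - k.+1%:R^-1.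
pose A k n := [set theta | (2^-1%:E < s_law M n theta (H n (q k)))%E].
have mA k n : measurable (A k n).
  rewrite -[X in measurable X]setTI; apply: emeasurable_fun_o_infty => //.
  exact: measurable_s_law.
(* Being below [t] means that, for some level [q k], the event [H n (q k)] eventually has
   probability above 1/2; each of these conditions is measurable in theta. *)
suff -> : Theta M `&` coord_g i @^-1` `]-oo, t[%classic =
    Theta M `&` \bigcup_k \bigcup_N \bigcap_(n in [set n | (N <= n)%N]) A k n.
  apply: measurableI => //; apply: bigcupT_measurable => k; apply: bigcupT_measurable => N.
  by apply: bigcap_measurable => //; exists N => /=.
have dichotomy theta k : Theta M theta ->
    (coord_g i theta < q k -> \forall n \near \oo, A k n theta) /\
    (q k < coord_g i theta -> \forall n \near \oo, ~ A k n theta).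
  move=> /std_cvg[X _ LX].
  apply: (@coordinate_dichotomy _ _ (fun n => s_prob M n theta) X a b (g theta)) => // e e0.
  by apply: filterS (LX e e0) => n LXn S /SS_rectangle; exact: LXn.
apply/seteqP; split=> theta -[Ttheta].
  rewrite /= in_itv /= => /ltr_add_invr [k gt_k]; split=> //; exists k => //.
  have [near_A _] := dichotomy theta k Ttheta.
  by case: near_A => [|N _ hN]; [rewrite /q ltrBrDr|exists N].
move=> [k _ [N _ AN]]; split=> //; rewrite /= in_itv /= ltNge; apply/negP => tg.
have [_ near_nA] := dichotomy theta k Ttheta.
case: near_nA => [|N' _ hN'].
  by apply: lt_le_trans tg; rewrite /q gtrBl invr_gt0.
apply: (hN' (maxn N N')); first exact: leq_maxr.
by apply: AN; exact: leq_maxl.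
Qed.

(** Measurability of [g] is known on the parameter set only; the extension by 0 is measurable
    everywhere and agrees with [g] where the prior is integrated. *)
Let g' theta : 'rV[R]_d := \row_i (coord_g i \_ (Theta M)) theta.

Let g'E theta : Theta M theta -> g' theta = g theta.
Proof. by move=> Theta_theta; apply/rowP => i; rewrite mxE patchE mem_set. Qed.

Let measurable_g' : measurable_fun setT g'.
Proof.
apply: measurable_fun_coordP => i j.
rewrite (_ : (fun _ => _) = coord_g j \_ (Theta M)); last first.
  by apply/funext => theta; rewrite /g' mxE.
by apply/(measurable_restrict _ _ _) => //; rewrite setTI; exact: measurable_location.
Qed.

Lemma measurable_std_n_law n S : measurable S -> measurable_fun (Theta M)
  (fun theta => std_n_law M a b g n theta [set v | S (row_mx theta v)]).
Proof.
move=> mS; pose V (ts : 'rV[R]_p * 'rV[R]_d) : 'rV[R]_(p + d) :=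
  row_mx ts.1 (standardize a b n%:R (g' ts.1) ts.2).
have mV : measurable_fun setT V.
  rewrite (_ : V = (fun tv : 'rV[R]_p * 'rV[R]_d => row_mx tv.1 tv.2) \o
    (fun ts => (ts.1, standardize a b n%:R (g' ts.1) ts.2)))//.
  apply: measurableT_comp; first exact: measurable_row_mx.
  apply: measurable_fun_pair => //.
  apply: measurable_standardize_param => //.
  by apply: measurableT_comp => //; exact: measurable_g'.
have mW : measurable (V @^-1` S) by rewrite -[X in measurable X]setTI; exact: mV.
apply: eq_measurable_fun (measurable_funTS (measurable_s_law_xsection M n mW)).
move=> theta; rewrite inE => Theta_theta; congr (s_law M n theta _).
by apply/seteqP; split=> s; rewrite /xsection /= inE /V /= g'E.
Qed.

Lemma measurable_std_ndp_law n S : measurable S -> measurable_fun (Theta M)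
  (fun theta => std_ndp_law M a b g n theta [set v | S (row_mx theta v)]).
Proof.
move=> mS; pose V (tsm : ('rV[R]_p * 'rV[R]_d) * measurableTypeR R) : 'rV[R]_(p + d) :=
  row_mx tsm.1.1 (standardize a b tsm.2 (g' tsm.1.1) tsm.1.2).
have mV : measurable_fun setT V.
  rewrite (_ : V = (fun tv : 'rV[R]_p * 'rV[R]_d => row_mx tv.1 tv.2) \o
    (fun tsm => (tsm.1.1, standardize a b tsm.2 (g' tsm.1.1) tsm.1.2)))//.
  apply: measurableT_comp; first exact: measurable_row_mx.
  apply: measurable_fun_pair; first by apply: measurableT_comp => //; exact: measurable_fst.
  apply: measurable_standardize_param => //.
    apply: (measurableT_comp measurable_g').
    by apply: measurableT_comp => //; exact: measurable_fst.
  by apply: measurableT_comp => //; exact: measurable_snd.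
have mW : measurable (V @^-1` S) by rewrite -[X in measurable X]setTI; exact: mV.
pose h := ndp_law M n \o xsection (V @^-1` S).
have mh : measurable_fun setT h by exact: measurable_fun_xsection.
have h0 z : (0 <= h z)%E by exact: measure_ge0.
apply: eq_measurable_fun (measurable_funTS (measurable_s_law_integral M n h0 mh)).
move=> theta; rewrite inE => Theta_theta; apply: eq_integral => s _ /=.
rewrite /h /=; congr (ndp_law M n _).
by apply/seteqP; split=> m; rewrite /xsection /= !inE /V /= g'E.
Qed.

Lemma measurable_s_law_row n S : measurable S ->
  measurable_fun setT (fun theta => s_law M n theta [set v |
    S (row_mx theta v : 'rV[R]_(p + d))]).
Proof.
move=> mS; pose V (ts : 'rV[R]_p * 'rV[R]_d) : 'rV[R]_(p + d) := row_mx ts.1 ts.2.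
have mW : measurable (V @^-1` S).
  by rewrite -[X in measurable X]setTI; exact: measurable_row_mx.
have := measurable_s_law_xsection M n mW; congr (measurable_fun _ _).
apply/funext => theta; congr (s_law M n theta _).
by apply/seteqP; split=> v; rewrite /xsection /= inE.
Qed.

Let prior_Theta_lty : (prior M (Theta M) < +oo)%E.
Proof.
apply: (@le_lt_trans _ _ (prior M setT)); first by rewrite le_measure ?inE.
by have -> : prior M setT = 1%E := proper; rewrite ltry.
Qed.

Lemma joint_std_ndp_close : A2a M a b c ->
  forall e : R, 0 < e -> \forall n \near \oo, forall S, SS' S ->
  (`|joint_law M (std_n_law M a b g n) S - joint_law M (std_ndp_law M a b g n) S| <= e%:E)%E.
Proof.
move=> a2a; apply: (@uniform_integral_dist _ _ _ (prior M) (Theta M) _ SS'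
  (fun n S theta => std_n_law M a b g n theta [set v | S (row_mx theta v)])
  (fun n S theta => std_ndp_law M a b g n theta [set v | S (row_mx theta v)])) => //.
- by exists setT.
- move=> n S _ /SS'_measurable mS.
  by split; [exact: measurable_std_n_law|exact: measurable_std_ndp_law].
- move=> n S theta _ /SS'_measurable mS _; have mSt := measurable_row_section theta mS.
  split; last exact: std_ndp_law01.
  by apply: s_law01; rewrite -[X in measurable X]setTI; exact: measurable_standardize.
- move=> theta Theta_theta e e0.
  have close := std_ndp_close b0 SS_measurable SS_affine std_cvg a2a Theta_theta e0.
  by apply: filterS close => n close_n S SSS; apply: close_n; exact: SS'_section.
Qed.

Lemma given_ndp_shift U (K : nat -> set U -> \bar R) y S :
  (forall k, (0 <= K k S)%E) ->
  given_ndp M K y S = (\sum_(k <oo) (posterior M y k.+1)%:E * K k.+1 S)%E.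
Proof.
move=> K0; rewrite /given_ndp -(nneseries_addn 1); last first.
  by move=> k; rewrite mule_ge0// lee_fin posterior_ge0.
by apply: eq_eseriesr => k _; rewrite addn1.
Qed.

(** The posterior weights do not depend on theta, so Tonelli exchanges the sum over [k] with the
    integral over the prior. *)
Lemma given_ndp_joint_law n0 S : measurable S ->
  given_ndp M (fun k => joint_law M (s_law M k)) n0%:R S =
  (\int[prior M]_(theta in Theta M)
     given_ndp M (fun k => s_law M k theta) n0%:R [set v | S (row_mx theta v)])%E.
Proof.
move=> mS; have post0 k : (0 <= (posterior M n0%:R k)%:E)%E by rewrite lee_fin posterior_ge0.
have mrow k := measurable_funTS (D := Theta M) (measurable_s_law_row k mS).
rewrite given_ndp_shift => [|k]; last by rewrite /joint_law integral_ge0.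
under [in RHS]eq_integral do rewrite given_ndp_shift//.
rewrite integral_nneseries//; last 2 first.
- by move=> k; apply: measurable_funeM; exact: mrow.
- by move=> k theta _; rewrite mule_ge0.
by apply: eq_eseriesr => k _; rewrite ge0_integralZl//; exact: mrow.
Qed.

Lemma joint_given_ndp_close : A2b M a b c ->
  forall e : R, 0 < e -> \forall n0 \near \oo, forall S, SS' S ->
  (`|joint_law M (s_law M n0) S -
     given_ndp M (fun k => joint_law M (s_law M k)) n0%:R S| <= e%:E)%E.
Proof.
move=> a2b e e0; have [_ ev _] := a2b.
suff : \forall n0 \near \oo, forall S, SS' S ->
    (`|\int[prior M]_(theta in Theta M) s_law M n0 theta [set v | S (row_mx theta v)] -
      \int[prior M]_(theta in Theta M)
        given_ndp M (fun k => s_law M k theta) n0%:R [set v | S (row_mx theta v)]| <= e%:E)%E.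
  apply: filterS => n close_n S SSS; rewrite given_ndp_joint_law; first exact: close_n.
  exact: SS'_measurable.
apply: (@uniform_integral_dist _ _ _ (prior M) (Theta M) _ SS'
  (fun n S theta => s_law M n theta [set v | S (row_mx theta v)])
  (fun n S theta => given_ndp M (fun k => s_law M k theta) n%:R [set v |
    S (row_mx theta v)])) => //.
- by exists setT.
- move=> n S _ /SS'_measurable mS.
  have mrow k := measurable_funTS (D := Theta M) (measurable_s_law_row k mS).
  split=> //.
  rewrite (_ : (fun _ => _) = fun theta => (\sum_(k <oo) (posterior M n%:R k.+1)%:E *
      s_law M k.+1 theta [set v | S (row_mx theta v)])%E); last first.
    by apply/funext => theta; rewrite given_ndp_shift.
  apply: ge0_emeasurable_sum => k.
    by move=> theta _ _; rewrite mule_ge0// lee_fin posterior_ge0.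
  by move=> _; apply: measurable_funeM; exact: mrow.
- move=> n S theta n1 /SS'_measurable mS _; have mSt := measurable_row_section theta mS.
  split; first exact: s_law01.
  by apply: given_ndp01; [exact: ev|move=> k; exact: s_law01].
- move=> theta Theta_theta x x0.
  have close := given_ndp_close b0 SS_measurable SS_affine std_cvg a2b Theta_theta x0.
  by apply: filterS close => n close_n S SSS; apply: close_n; exact: SS'_section.
Qed.

End joint_convergence.

(** * Conclusion *)

Section sup_distances.
Context {R : realType} {U : Type} (C : set (set U)).

(** A member of [C] keeps the supremum nonnegative; over an empty class it would be [-oo]. *)
Lemma ereal_sup_dist_cvg0 (P Q : nat -> set U -> \bar R) : C !=set0 ->
  (forall e : R, 0 < e -> \forall n \near \oo, forall S, C S ->
    (`|P n S - Q n S| <= e%:E)%E) ->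
  (fun n => ereal_sup [set `|P n S - Q n S|%E | S in C]) @ \oo --> 0%E.
Proof.
move=> [S0 CS0] PQ; apply: ge0_cvge0 => [n|e e0].
  by apply: (@le_trans _ _ `|P n S0 - Q n S0|%E) => //; apply: ereal_sup_ubound; exists S0.
apply: filterS (PQ e e0) => n PQn; apply: ge_ereal_sup => _ [S CS <-]; exact: PQn.
Qed.

Lemma cvg0_ereal_sup_dist (P : nat -> set U -> \bar R) (Q : set U -> \bar R) :
  (fun n => ereal_sup [set `|P n S - Q S|%E | S in C]) @ \oo --> 0%E ->
  forall e : R, 0 < e -> \forall n \near \oo, forall S, C S -> (`|P n S - Q S| <= e%:E)%E.
Proof.
move=> PQ e e0; apply: filterS (cvge_near PQ e0) => n []; rewrite add0e => PQn _ S CS.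
by apply: le_trans PQn; apply: ereal_sup_ubound; exists S.
Qed.

End sup_distances.

Lemma rectangleT (R : realType) d : rectangle [set: 'rV[R]_d].
Proof.
exists (fun=> `]-oo, +oo[); apply/seteqP; split=> // v _ i /=; by rewrite in_itv.
Qed.

Lemma affine_itv (R : realType) (a u : R) (I : interval R) : 0 < a ->
  exists I' : interval R, forall x, (a * x + u \in I) = (x \in I').
Proof.
move=> a0; pose f (z : itv_bound R) :=
  if z is BSide s y then BSide s ((y - u) / a) else z.
case: I => l r; exists (Interval (f l) (f r)) => x; rewrite !itv_boundlr.
congr (_ && _).
  case: l => [[] y|[]] //=; rewrite !bnd_simp.
    by rewrite ler_pdivrMr// mulrC lerBlDr.
  by rewrite ltr_pdivrMr// mulrC ltrBlDr.
case: r => [[] y|[]] //=; rewrite !bnd_simp.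
  by rewrite ltr_pdivlMr// mulrC ltrBrDr.
by rewrite ler_pdivlMr// mulrC lerBrDr.
Qed.

Lemma rectangle_affine (R : realType) d (a : R) (u : 'rV[R]_d) S : 0 < a ->
  rectangle S -> rectangle (affine a u @^-1` S).
Proof.
move=> a0 [I ->].
have /choice[I' I'P] i := affine_itv (u 0 i) (I i) a0.
exists I'; apply/seteqP; split=> v /= h i; move: (h i); by rewrite /affine !mxE I'P.
Qed.

(** The section is empty when [theta] violates its own constraints. This case is listed apart
    because for [d = 0] the empty set is not a rectangle. *)
Lemma rectangle_section (R : realType) p d (S : set 'rV[R]_(p + d)) (theta : 'rV[R]_p) :
  rectangle S -> rectangle [set v : 'rV[R]_d | S (row_mx theta v)] \/
    [set v : 'rV[R]_d | S (row_mx theta v)] = set0.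
Proof.
move=> [I ->]; have [thetaI|thetaI] := pselect (forall k, theta 0 k \in I (lshift d k)).
  left; exists (fun k => I (rshift p k)); apply/seteqP; split=> v /= h.
    by move=> k; have := h (rshift p k); rewrite row_mxEr.
  by move=> i; case: (split_ordP i) => k ->; rewrite ?row_mxEl ?row_mxEr.
right; apply/seteqP; split=> // v /= h; apply: thetaI => k.
by have := h (lshift d k); rewrite row_mxEl.
Qed.

Theorem theorem3p1 (R : realType) (p d : nat) (dT : measure_display)
    (T : measurableType dT) (M : dp_model R p d T) (a b : R)
    (g : 'rV[R]_p -> 'rV[R]_d) (c : nat -> R) :
  (A1 M a b g ->
    (A2a M a b c ->
      (forall theta, Theta M theta ->
        (fun n => KS (std_n_law M a b g n theta) (std_ndp_law M a b g n theta))
          @ \oo --> 0%E) /\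
      (proper_prior M ->
        (fun n => KS (joint_law M (std_n_law M a b g n))
                     (joint_law M (std_ndp_law M a b g n)))
          @ \oo --> 0%E)) /\
    (A2b M a b c ->
      (forall theta, Theta M theta ->
        (fun n0 => KS (s_law M n0 theta)
                      (given_ndp M (fun k => s_law M k theta) n0%:R))
          @ \oo --> 0%E) /\
      (proper_prior M ->
        (fun n0 => KS (joint_law M (s_law M n0))
                      (given_ndp M (fun k => joint_law M (s_law M k)) n0%:R))
          @ \oo --> 0%E))) /\
  (A1' M a b g ->
    (A2a M a b c ->
      (forall theta, Theta M theta ->
        (fun n => TV (std_n_law M a b g n theta) (std_ndp_law M a b g n theta))
          @ \oo --> 0%E) /\
      (proper_prior M ->
        (fun n => TV (joint_law M (std_n_law M a b g n))
                     (joint_law M (std_ndp_law M a b g n)))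
          @ \oo --> 0%E)) /\
    (A2b M a b c ->
      (forall theta, Theta M theta ->
        (fun n0 => TV (s_law M n0 theta)
                      (given_ndp M (fun k => s_law M k theta) n0%:R))
          @ \oo --> 0%E) /\
      (proper_prior M ->
        (fun n0 => TV (joint_law M (s_law M n0))
                      (given_ndp M (fun k => joint_law M (s_law M k)) n0%:R))
          @ \oo --> 0%E))).
Proof.
have rect0 k : (@rectangle R k) !=set0 by exists setT; exact: rectangleT.
have meas0 k : @measurable _ 'rV[R]_k !=set0 by exists setT; exact: measurableT.
split=> [[b0 _ std_cvg]|[b0 _ std_cvg]].
- (* a section of a rectangle may be empty *)
  pose SS (S : set 'rV[R]_d) := rectangle S \/ S = set0.
  have SS_measurable : SS `<=` measurable.
    by move=> S [/measurable_rectangle//|->]; exact: measurable0.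
  have SS_rectangle : rectangle `<=` SS by move=> S; left.
  have SS_affine (x : R) u S : 0 < x -> SS S -> SS (affine x u @^-1` S).
    move=> x0 [rS|->]; last by right; rewrite preimage_set0.
    by left; exact: rectangle_affine.
  have SS_section (S : set 'rV[R]_(p + d)) theta :
      rectangle S -> SS [set v | S (row_mx theta v)] by exact: rectangle_section.
  have measR := @measurable_rectangle R (p + d).
  have rectT := @rectangleT R (p + d).
  have SS_cvg theta : Theta M theta ->
      exists2 X : probability 'rV[R]_d R, continuous_law X & forall e : R, 0 < e ->
        \forall n \near \oo, forall S, SS S ->
          (`|std_n_law M a b g n theta S - X S| <= e%:E)%E.
    move=> /std_cvg[X [cX _ cvgX]]; exists X => // e e0.
    have cvg_rect := @cvg_in_distribution_rectangle R d
      (fun n => std_prob M a b g n theta) X cX cvgX e e0.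
    apply: filterS cvg_rect => n h S [|->]; first exact: h.
    have -> : std_n_law M a b g n theta set0 = 0%E := measure0 (std_prob M a b g n theta).
    rewrite measure0.
    by rewrite sube0 abse0 lee_fin ltW.
  split=> A2; split=> [theta Theta_theta|proper];
    apply: (ereal_sup_dist_cvg0 (rect0 _)) => e e0.
  + have close := std_ndp_close b0 SS_measurable SS_affine SS_cvg A2 Theta_theta e0.
    by apply: filterS close => n close_n S /SS_rectangle; exact: close_n.
  + exact: (joint_std_ndp_close b0 SS_measurable SS_rectangle SS_affine
      measR rectT SS_section SS_cvg proper A2).
  + have close := given_ndp_close b0 SS_measurable SS_affine SS_cvg A2 Theta_theta e0.
    by apply: filterS close => n close_n S /SS_rectangle; exact: close_n.
  + exact: (joint_given_ndp_close b0 SS_measurable SS_affine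
      measR rectT SS_section SS_cvg proper A2).
- have SS_measurable : (@measurable _ 'rV[R]_d) `<=` measurable by [].
  have SS_rectangle := @measurable_rectangle R d.
  have SS_affine (x : R) u (S : set 'rV[R]_d) :
      0 < x -> measurable S -> measurable (affine x u @^-1` S).
    move=> _ mS; rewrite -[X in measurable X]setTI; exact: measurable_affine.
  have SS_section (S : set 'rV[R]_(p + d)) theta :
      measurable S -> measurable [set v | S (row_mx theta v)].
    exact: measurable_row_section.
  have SS_cvg theta : Theta M theta ->
      exists2 X : probability 'rV[R]_d R, continuous_law X & forall e : R, 0 < e ->
        \forall n \near \oo, forall S, measurable S ->
          (`|std_n_law M a b g n theta S - X S| <= e%:E)%E.
    by move=> /std_cvg[X [cX _ cvgX]]; exists X => //; exact: cvg0_ereal_sup_dist.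
  split=> A2; split=> [theta Theta_theta|proper];
    apply: (ereal_sup_dist_cvg0 (meas0 _)) => e e0.
  + exact: (std_ndp_close b0 SS_measurable SS_affine SS_cvg A2).
  + exact: (joint_std_ndp_close b0 SS_measurable SS_rectangle SS_affine
      (fun S mS => mS) measurableT SS_section SS_cvg proper A2).
  + exact: (given_ndp_close b0 SS_measurable SS_affine SS_cvg A2).
  + exact: (joint_given_ndp_close b0 SS_measurable SS_affine
      (fun S mS => mS) measurableT SS_section SS_cvg proper A2).
Qed.
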